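(* Let $p\ge3$ be odd, $q$ a primitive $p$-th root of unity with a fixed square root $q^{1/2}$, and let $\lambda=(\lambda_+,\lambda_-)\in\mathbb R^2\setminus\{(0,0)\}$, $\lambda^2:=\lambda_+\lambda_-$, $\xi:=q\,\eta_+\eta_-$. The matrix elements $D^\lambda_{mn}=\{\delta^{p-m}\otimes1_A,\ T^\lambda\delta^n\}_S$, $m,n\in\{0,\dots,p-1\}$, of the pseudo-unitary irreducible representation $T^\lambda$ of $E_q(1,1)$ are as follows. For $n\ge m$, $$D^\lambda_{mn}=e^{-i\lambda_+^pz_+-i\lambda_-^pz_-}\Big[\sum_{k=0}^{p-1-n+m}\frac{(-\lambda^2)^kq^{-k(m+n)}}{[k]!\,[k+n-m]!}\,\xi^k\,(-iq^{\frac12-n}\lambda_-\eta_-)^{n-m}\delta^n+(-iq^{-\frac12-n}\lambda_+\eta_+)^{p+m-n}\delta^n\sum_{k=0}^{n-m-1}\frac{(-\lambda^2)^kq^{k(m+n)}}{[k]!\,[k+p+m-n]!}\,\xi^k\Big],$$ and for $m\ge n$, $$D^\lambda_{mn}=e^{-i\lambda_+^pz_+-i\lambda_-^pz_-}\Big[\sum_{k=0}^{m-n-1}\frac{(-\lambda^2)^kq^{-k(m+n)}}{[k]!\,[k+p+n-m]!}\,\xi^k\,(-iq^{\frac12-n}\lambda_-\eta_-)^{p+n-m}\delta^n+(-iq^{-\frac12-n}\lambda_+\eta_+)^{m-n}\delta^n\sum_{k=0}^{p-1-m+n}\frac{(-\lambda^2)^kq^{k(m+n)}}{[k]!\,[k+m-n]!}\,\xi^k\Big],$$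 where empty sums are $0$.
   Context: $[n]=\frac{q^n-q^{-n}}{q-q^{-1}}$, $[n]!=[1]\cdots[n]$, $[0]!=1$; $0^0=1$. $A(E_q(1,1))=A(E(1,1\mid p))\otimes C^\infty(\mathbb R^2)$, where $C^\infty(\mathbb R^2)$ consists of smooth functions of $z_+,z_-$ (commuting with $\eta_\pm,\delta$), and $A(E(1,1\mid p))$ is generated by $\eta_\pm,\delta$ with $\eta_-\eta_+=q^2\eta_+\eta_-$, $\eta_\pm\delta=q^2\delta\eta_\pm$, $\delta^p=1_A$, $\eta_\pm^p=0$. Involution: $\delta^*=\delta$, $\eta_\pm^*=\eta_\pm$, $f^*=\bar f$. $A(SO(1,1\mid p))$ is the subalgebra of polynomials in $\delta$ ($\delta^p=1$), basis $\delta^0,\dots,\delta^{p-1}$. $U_q(e(1,1))$ is generated by $p_\pm,\kappa$ with $p_+p_-=p_-p_+$, $p_\pm\kappa=q^{\mp1}\kappa p_\pm$, $\kappa^p=1$; $P_\pm=p_\pm^p$. The representation $\mathcal L^\lambda$ of $U_q(e(1,1))$ on $A(SO(1,1\mid p))$ is $\mathcal L^\lambda(p_\pm)\delta^m=\lambda_\pm\delta^{m\pm1}$, $\mathcal L^\lambda(\kappa)\delta^m=q^m\delta^m$ (so $\mathcal L^\lambda(P_\pm)=\lambda_\pm^p\,\mathrm{id}$). The representation $T^\lambda:A(SO(1,1\mid p))\to A(SO(1,1\mid p))\otimes A(E_q(1,1))$ is $$T^\lambda a=e^{-i\mathcal L^\lambda(P_+)\otimes z_+-i\mathcal L^\lambda(P_-)\otimes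 z_-}\,e_+^{\,i\mathcal L^\lambda(\epsilon_+)\otimes\eta_+}\,e_-^{\,i\mathcal L^\lambda(\epsilon_-)\otimes\eta_-}\,D(\mathcal L^\lambda(\kappa),\delta)\,(a\otimes1_A),$$ where $\epsilon_\pm=-q^{\mp1/2}p_\pm\kappa^{-1}$, $e_\pm^x=\sum_{m=0}^{p-1}\frac{q^{\pm m(m-1)/2}}{[m]!}x^m$, $D(\kappa,\delta)=\frac1p\sum_{m,k=0}^{p-1}q^{-mk}\kappa^m\otimes\delta^k$; first tensor factors act as operators on $A(SO(1,1\mid p))$ and second factors act by left multiplication in $A(E_q(1,1))$. The form on $A(SO(1,1\mid p))$ is $(a,b)_S=\mathcal I_S(a^*b)$ with $\mathcal I_S(\delta^m)=1$ if $m\equiv0\ (\mathrm{mod}\ p)$ and $0$ otherwise, extended by $\{a\otimes F,b\otimes G\}_S=F^*G\,(a,b)_S$ for $F,G\in A(E_q(1,1))$. Equivalently $T^\lambda\delta^n=\sum_{m=0}^{p-1}\delta^m\otimes D^\lambda_{mn}$. *)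

(* Defs.v *)
From HB Require Import structures.
From mathcomp Require Import all_boot all_order all_algebra.
From mathcomp Require Import complex.
From mathcomp Require Import all_classical all_reals all_analysis.
From mathcomp Require Import ring zify.

Set Implicit Arguments.
Unset Strict Implicit.
Unset Printing Implicit Defensive.

Import Order.TTheory GRing.Theory Num.Theory numFieldNormedType.Exports.

Local Open Scope classical_set_scope.
Local Open Scope ring_scope.
Local Open Scope complex_scope.

(* For a primitive p-th root of unity q in a field F and a commutative
   F-algebra K, [Ealg K hq] is the F-algebra A(E(1,1|p)) (x)_F K, where
   A(E(1,1|p)) is presented by eta_+, eta_-, delta and the relations
     eta_- eta_+ = q^2 eta_+ eta_-,   eta_(+-) delta = q^2 delta eta_(+-),
     delta^p = 1,                     eta_(+-)^p = 0.
   An element is stored as the family of its coefficients, in K, on the ordered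
   monomials eta_+^a eta_-^b delta^c with a, b, c < p.  The relations are
   [etam_etap], [etap_delta], [etam_delta], [deltaXp], [etapXp], [etamXp];
   [Ealg_spanE] and [Ealg_univ] say that no others hold.  A(E_q(1,1)) is
   the case F = R[i], K = C^oo(R^2). *)
Definition Ealg (F : fieldType) (K : comAlgType F) (p : nat) (q : F)
    (hq : p.-primitive_root q) : Type :=
  {ffun 'I_p * 'I_p * 'I_p -> K}.

Section Ealg_ring.
Context {F : fieldType} {K : comAlgType F} {p : nat} {q : F}.
Variable hq : p.-primitive_root q.
Local Notation A := (Ealg K hq).

HB.instance Definition _ := GRing.Lmodule.on A.

(* f eta_+^a eta_-^b delta^c; it vanishes when p <= a or p <= b. *)
Definition Emon (f : K) (a b c : nat) : A :=
  [ffun t : 'I_p * 'I_p * 'I_p =>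
     if [&& t.1.1 == a :> nat, t.1.2 == b :> nat & t.2 == c %% p :> nat]%N
     then f else 0].

(* From delta eta_(+-) = q^-2 eta_(+-) delta :
   (eta_+^a eta_-^b delta^c) (eta_+^a' eta_-^b' delta^c') =
     [Ecoef b c a' b'] eta_+^(a+a') eta_-^(b+b') delta^(c+c'). *)
Definition Ecoef (b c a' b' : nat) : F :=
  q ^+ (2 * (b * a')) * (q ^- c) ^+ (2 * (a' + b')).

Definition Emul (x y : A) : A :=
  \sum_(s : 'I_p * 'I_p * 'I_p) \sum_(u : 'I_p * 'I_p * 'I_p)
    Emon (Ecoef s.1.2 s.2 u.1.1 u.1.2 *: (x s * y u))
      (s.1.1 + u.1.1) (s.1.2 + u.1.2) (s.2 + u.2).

Fact p_gt0 : (0 < p)%N. Proof. exact: prim_order_gt0 hq. Qed.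

Fact EmonD f g a b c : Emon (f + g) a b c = Emon f a b c + Emon g a b c.
Proof. by apply/ffunP => t; rewrite !ffunE; case: ifP; rewrite ?addr0. Qed.

Fact Emon0 a b c : Emon 0 a b c = 0.
Proof. by apply/ffunP => t; rewrite !ffunE if_same. Qed.

Fact EmonZ k f a b c : Emon (k *: f) a b c = k *: Emon f a b c.
Proof. by apply/ffunP => t; rewrite !ffunE; case: ifP; rewrite ?scaler0. Qed.

Fact Emon_mod f a b c : Emon f a b (c %% p) = Emon f a b c.
Proof. by apply/ffunP => t; rewrite !ffunE modn_mod. Qed.

Fact Emon_geA f a b c : (p <= a)%N -> Emon f a b c = 0.
Proof.
move=> le_pa; apply/ffunP => t; rewrite !ffunE.
by rewrite ltn_eqF// (leq_trans (ltn_ord _) le_pa).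
Qed.

Fact Emon_geB f a b c : (p <= b)%N -> Emon f a b c = 0.
Proof.
move=> le_pb; apply/ffunP => t; rewrite !ffunE.
by rewrite (@ltn_eqF t.1.2) ?andbF// (leq_trans (ltn_ord _) le_pb).
Qed.

Fact Ealg_monE (x : A) : x = \sum_(t : _) Emon (x t) t.1.1 t.1.2 t.2.
Proof.
apply/ffunP => u; rewrite sum_ffunE (bigD1 u)//= big1 ?addr0 ?ffunE.
  by rewrite !eqxx/= modn_small ?eqxx.
move=> [[a b] c] ne_u; rewrite !ffunE modn_small//=.
case: ifP => // /and3P[/eqP ea /eqP eb /eqP ec]; case/negP: ne_u.
by apply/eqP; case: u ea eb ec => [[a' b'] c'] /= ? ? ?;
  congr (_, _, _); apply/val_inj.
Qed.

Fact EmulDl : left_distributive Emul +%R.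
Proof.
move=> x y z; rewrite -big_split; apply: eq_bigr => s _ /=.
rewrite -big_split; apply: eq_bigr => u _ /=.
by rewrite ffunE mulrDl scalerDr EmonD.
Qed.

Fact EmulDr : right_distributive Emul +%R.
Proof.
move=> x y z; rewrite -big_split; apply: eq_bigr => s _ /=.
rewrite -big_split; apply: eq_bigr => u _ /=.
by rewrite ffunE mulrDr scalerDr EmonD.
Qed.

Fact Emul0l x : Emul 0 x = 0.
Proof. by apply: (addrI (Emul 0 x)); rewrite -EmulDl !addr0. Qed.

Fact Emul0r x : Emul x 0 = 0.
Proof. by apply: (addrI (Emul x 0)); rewrite -EmulDr !addr0. Qed.

Fact Emul_suml (I : Type) (r : seq I) (f : I -> A) x :
  Emul (\sum_(i <- r) f i) x = \sum_(i <- r) Emul (f i) x.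
Proof. exact: (big_morph (Emul^~ x) (fun y z => EmulDl y z x) (Emul0l x)). Qed.

Fact Emul_sumr (I : Type) (r : seq I) (f : I -> A) x :
  Emul x (\sum_(i <- r) f i) = \sum_(i <- r) Emul x (f i).
Proof. exact: (big_morph (Emul x) (EmulDr x) (Emul0r x)). Qed.

Fact qV_mod c : q ^- (c %% p) = q ^- c.
Proof. by rewrite (prim_expr_mod hq). Qed.

Fact EmulM f g a b c a' b' c' :
  Emul (Emon f a b c) (Emon g a' b' c') =
  Emon (Ecoef b c a' b' *: (f * g)) (a + a') (b + b') (c + c').
Proof.
have [le_p|lta] := leqP p a.
  by rewrite (Emon_geA f b c le_p) Emul0l Emon_geA// (leq_trans le_p)// leq_addr.
have [le_p|lta'] := leqP p a'.
  by rewrite (Emon_geA g b' c' le_p) Emul0r Emon_geA// (leq_trans le_p)// leq_addl.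
have [le_p|ltb] := leqP p b.
  by rewrite (Emon_geB f a c le_p) Emul0l Emon_geB// (leq_trans le_p)// leq_addr.
have [le_p|ltb'] := leqP p b'.
  by rewrite (Emon_geB g a' c' le_p) Emul0r Emon_geB// (leq_trans le_p)// leq_addl.
have hc i : (i %% p < p)%N by rewrite ltn_mod p_gt0.
pose s0 := (Ordinal lta, Ordinal ltb, Ordinal (hc c)).
pose u0 := (Ordinal lta', Ordinal ltb', Ordinal (hc c')).
rewrite /Emul (bigD1 s0)//= [X in _ + X]big1 ?addr0 => [|[[sa sb] sc] ne_s].
  rewrite (bigD1 u0)//= [X in _ + X]big1 ?addr0 => [|[[ua ub] uc] ne_u].
    rewrite !ffunE/= !eqxx/= /Ecoef qV_mod.
    by apply/ffunP => t; rewrite !ffunE modnDml modnDmr.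
  rewrite [X in _ * X]ffunE/=; case: ifP; last by rewrite mulr0 scaler0 Emon0.
  move=> /and3P[/eqP ea /eqP eb /eqP ec]; case/negP: ne_u; apply/eqP.
  by congr (_, _, _); apply/val_inj.
apply: big1 => u _; rewrite [X in X * _]ffunE/=.
case: ifP; last by rewrite mul0r scaler0 Emon0.
move=> /and3P[/eqP ea /eqP eb /eqP ec]; case/negP: ne_s; apply/eqP.
by congr (_, _, _); apply/val_inj.
Qed.

Fact EmulA : associative Emul.
Proof.
move=> x y z; rewrite (Ealg_monE x) (Ealg_monE y) (Ealg_monE z).
rewrite !Emul_suml; apply: eq_bigr => s _.
rewrite [in RHS](Emul_sumr _ _ (Emon (x s) _ _ _)) Emul_suml Emul_sumr.
apply: eq_bigr => u _.
rewrite !Emul_sumr; apply: eq_bigr => w _.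
rewrite !EmulM !addnA; congr (Emon _ _ _ _).
rewrite -scalerAr -scalerAl !scalerA (mulrA (x s)); congr (_ *: _).
rewrite /Ecoef -!exprVn -!exprM [LHS]mulrACA [RHS]mulrACA -!exprD.
by congr (_ ^+ _ * _ ^+ _); lia.
Qed.


Definition Eone : A := Emon 1 0 0 0.

Fact Emul1 : left_id Eone Emul.
Proof.
move=> x; rewrite (Ealg_monE x) Emul_sumr; apply: eq_bigr => s _.
by rewrite EmulM mul1r /Ecoef !mul0n !muln0 !expr0 invr1 expr1n mulr1 scale1r.
Qed.

Fact Emulr1 : right_id Eone Emul.
Proof.
move=> x; rewrite (Ealg_monE x) Emul_suml; apply: eq_bigr => s _.
by rewrite EmulM mulr1 /Ecoef !muln0 !addn0 !expr0 mulr1 scale1r.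
Qed.

Fact Eone_neq0 : Eone != 0.
Proof.
apply/eqP => /ffunP /(_ (Ordinal p_gt0, Ordinal p_gt0, Ordinal p_gt0)).
by rewrite !ffunE /= mod0n /=; apply/eqP/oner_neq0.
Qed.

HB.instance Definition _ := GRing.Zmodule_isNzRing.Build A
  EmulA Emul1 Emulr1 EmulDl EmulDr Eone_neq0.

Fact EscaleAl (k : F) (x y : A) : k *: (x * y) = (k *: x) * y.
Proof.
rewrite /GRing.mul/= /Emul scaler_sumr; apply: eq_bigr => s _.
rewrite scaler_sumr; apply: eq_bigr => u _.
by rewrite -EmonZ ffunE -scalerAl !scalerA mulrC.
Qed.

Fact EscaleAr (k : F) (x y : A) : k *: (x * y) = x * (k *: y).
Proof.
rewrite /GRing.mul/= /Emul scaler_sumr; apply: eq_bigr => s _.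
rewrite scaler_sumr; apply: eq_bigr => u _.
by rewrite -EmonZ ffunE -scalerAr !scalerA mulrC.
Qed.

HB.instance Definition _ := GRing.Lmodule_isLalgebra.Build F A EscaleAl.
HB.instance Definition _ := GRing.Lalgebra_isAlgebra.Build F A EscaleAr.

Definition etap : A := Emon 1 1 0 0.
Definition etam : A := Emon 1 0 1 0.
Definition delta : A := Emon 1 0 0 1.

(* The embedding K -> A(E(1,1|p)) (x) K. *)
Definition Ecoeff (f : K) : A := Emon f 0 0 0.

Lemma EmonM f g a b c a' b' c' :
  Emon f a b c * Emon g a' b' c' =
  Emon (Ecoef b c a' b' *: (f * g)) (a + a') (b + b') (c + c').
Proof. exact: EmulM. Qed.

Lemma Ecoef00 b a' b' : Ecoef b 0 a' b' = q ^+ (2 * (b * a')).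
Proof. by rewrite /Ecoef expr0 invr1 expr1n mulr1. Qed.

Lemma etapX n : etap ^+ n = Emon 1 n 0 0.
Proof.
elim: n => // n IHn; rewrite exprS IHn EmonM Ecoef00 mul0n ?muln0 expr0.
by rewrite ?mulr1 scale1r ?mulr1.
Qed.

Lemma etamX n : etam ^+ n = Emon 1 0 n 0.
Proof.
elim: n => // n IHn; rewrite exprS IHn EmonM Ecoef00 !muln0 expr0.
by rewrite ?mulr1 scale1r ?mulr1.
Qed.

Lemma deltaX n : delta ^+ n = Emon 1 0 0 n.
Proof.
elim: n => // n IHn; rewrite exprS IHn EmonM /Ecoef !muln0 !expr0 mulr1.
by rewrite ?mulr1 scale1r ?mulr1.
Qed.

Lemma etam_etap : etam * etap = q ^+ 2 *: (etap * etam).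
Proof.
by rewrite !EmonM !Ecoef00 -EmonZ !mulr1 !mul0n !muln0 expr0 scale1r !muln1.
Qed.

Fact Ecoef_delta : q ^+ 2 * q ^- 1 ^+ 2 = 1.
Proof.
by rewrite exprVn divff// expf_neq0// (prim_root_eq0 hq) -lt0n p_gt0.
Qed.

Lemma etap_delta : etap * delta = q ^+ 2 *: (delta * etap).
Proof.
rewrite !EmonM Ecoef00 -EmonZ mulr1 scalerA /Ecoef !mul0n !muln0 addn0 !muln1.
by rewrite expr0 mul1r Ecoef_delta.
Qed.

Lemma etam_delta : etam * delta = q ^+ 2 *: (delta * etam).
Proof.
rewrite !EmonM Ecoef00 -EmonZ mulr1 scalerA /Ecoef !mul0n !muln0 add0n !muln1.
by rewrite expr0 mul1r Ecoef_delta.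
Qed.

Lemma deltaXp : delta ^+ p = 1.
Proof. by rewrite deltaX -Emon_mod modnn. Qed.

Lemma etapXp : etap ^+ p = 0.
Proof. by rewrite etapX Emon_geA. Qed.

Lemma etamXp : etam ^+ p = 0.
Proof. by rewrite etamX Emon_geB. Qed.

Fact Ecoeff_zmod : zmod_morphism Ecoeff.
Proof.
move=> f g; rewrite /Ecoeff EmonD; congr (_ + _).
by rewrite -scaleN1r EmonZ scaleN1r.
Qed.

Fact Ecoeff_monoid : monoid_morphism Ecoeff.
Proof.
by split=> // f g; rewrite EmonM Ecoef00 mul0n ?muln0 expr0 scale1r.
Qed.

Fact Ecoeff_scalable : scalable Ecoeff.
Proof. by move=> k f; rewrite /Ecoeff EmonZ. Qed.

HB.instance Definition _ := GRing.isZmodMorphism.Build K A Ecoeff Ecoeff_zmod.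
HB.instance Definition _ :=
  GRing.isMonoidMorphism.Build K A Ecoeff Ecoeff_monoid.
HB.instance Definition _ := GRing.isScalable.Build F K A *:%R Ecoeff
  Ecoeff_scalable.

Lemma Ecoeff_comm f (x : A) : Ecoeff f * x = x * Ecoeff f.
Proof.
rewrite (Ealg_monE x) mulr_suml mulr_sumr; apply: eq_bigr => s _.
rewrite !EmonM Ecoef00 /Ecoef mul0n !muln0 expr0 mulr1 mulrC.
by rewrite !add0n !addn0.
Qed.

Lemma EmonE f a b c :
  Emon f a b c = Ecoeff f * etap ^+ a * etam ^+ b * delta ^+ c.
Proof.
rewrite etapX etamX deltaX !EmonM !Ecoef00 /Ecoef !mul0n !muln0 !expr0.
by rewrite !scale1r !mulr1 !add0n !addn0.
Qed.

Lemma Ealg_spanE (x : A) :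
  x = \sum_(t : _) Ecoeff (x t) * etap ^+ t.1.1 * etam ^+ t.1.2 * delta ^+ t.2.
Proof. by rewrite [LHS]Ealg_monE; apply: eq_bigr => t _; rewrite EmonE. Qed.

Section Ealg_universal.
Variables (B : algType F) (j : {lrmorphism K -> B}) (x y d : B).
Hypothesis (jx : forall f, GRing.comm (j f) x).
Hypothesis (jy : forall f, GRing.comm (j f) y).
Hypothesis (jd : forall f, GRing.comm (j f) d).
Hypothesis (yx : y * x = q ^+ 2 *: (x * y)).
Hypothesis (xd : x * d = q ^+ 2 *: (d * x)).
Hypothesis (yd : y * d = q ^+ 2 *: (d * y)).
Hypothesis (dp : d ^+ p = 1) (xp : x ^+ p = 0) (yp : y ^+ p = 0).

Let ev (f : K) (a b c : nat) : B := j f * x ^+ a * y ^+ b * d ^+ c.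

Let phi (z : A) : B := \sum_(t : _) ev (z t) t.1.1 t.1.2 t.2.

Fact exp_qcomm (u v : B) (k : F) m n : v * u = k *: (u * v) ->
  v ^+ m * u ^+ n = k ^+ (m * n) *: (u ^+ n * v ^+ m).
Proof.
move=> vu; have vun : v * u ^+ n = k ^+ n *: (u ^+ n * v).
  elim: n => [|n IHn]; first by rewrite !expr0 mul1r mulr1 scale1r.
  rewrite [u ^+ n.+1]exprS mulrA vu -scalerAl -(mulrA u v) IHn -scalerAr.
  by rewrite scalerA mulrA -!exprS.
elim: m => [|m IHm]; first by rewrite mul0n !expr0 mul1r mulr1 scale1r.
rewrite exprS -mulrA IHm -scalerAr (mulrA v) vun -scalerAl scalerA -mulrA.
by rewrite mulSn exprD mulrC.
Qed.

Fact phi_mon f a b c : phi (Emon f a b c) = ev f a b c.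
Proof.
have ev0 a' b' c' : ev 0 a' b' c' = 0 by rewrite /ev raddf0 !mul0r.
have [pa|pa] := leqP p a.
  rewrite Emon_geA// /phi /ev -(subnKC pa) exprD xp mul0r mulr0 !mul0r.
  by apply: big1 => t _; rewrite ffunE raddf0 !mul0r.
have [pb|pb] := leqP p b.
  rewrite Emon_geB// /phi /ev -(subnKC pb) [y ^+ _]exprD yp mul0r mulr0 mul0r.
  by apply: big1 => t _; rewrite ffunE raddf0 !mul0r.
have pc : (c %% p < p)%N by rewrite ltn_mod p_gt0.
rewrite /phi (bigD1 (Ordinal pa, Ordinal pb, Ordinal pc))//= big1 ?addr0.
  rewrite ffunE /= !eqxx /ev; congr (_ * _).
  by rewrite [in RHS](divn_eq c p) exprD mulnC exprM dp expr1n mul1r.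
move=> [[a' b'] c'] ne_t; rewrite ffunE/=; case: ifP => // /and3P[].
move=> /eqP ea /eqP eb /eqP ec; case/negP: ne_t; apply/eqP.
by congr (_, _, _); apply/val_inj.
Qed.

Fact ev_mul f g a b c a' b' c' : ev f a b c * ev g a' b' c' =
  ev (Ecoef b c a' b' *: (f * g)) (a + a') (b + b') (c + c').
Proof.
have q0 : q != 0 by rewrite (prim_root_eq0 hq) -lt0n p_gt0.
have q20 : q ^+ 2 != 0 by rewrite expf_neq0.
have dx : d * x = (q ^- 2) *: (x * d) by rewrite xd scalerA mulVf// scale1r.
have dy : d * y = (q ^- 2) *: (y * d) by rewrite yd scalerA mulVf// scale1r.
have jX z : (forall f, GRing.comm (j f) z) ->
    forall n, z ^+ n * j g = j g * z ^+ n.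
  by move=> jz n; apply/esym/commrX/jz.
rewrite /ev linearZ /= rmorphM /= -!scalerAl.
rewrite -[LHS]mulrA !(mulrA (d ^+ c)) jX// -!mulrA.
rewrite (mulrA (d ^+ c)) (exp_qcomm _ _ dx) -!scalerAl -!scalerAr.
rewrite -(mulrA (x ^+ a')) (mulrA (d ^+ c)) (exp_qcomm _ _ dy).
rewrite -!scalerAl -!scalerAr -(mulrA (y ^+ b')) -exprD.
rewrite (mulrA (y ^+ b)) jX// -(mulrA (j g)) (mulrA (y ^+ b)).
rewrite (exp_qcomm _ _ yx) -!scalerAl -!scalerAr !scalerA.
rewrite (mulrA (x ^+ a)) jX// -!mulrA; congr (_ *: _).
  rewrite mulrA mulrC /Ecoef -!exprVn -!exprM -exprD.
  by congr (_ ^+ _ * _ ^+ _); lia.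
by rewrite !exprD !mulrA.
Qed.

Lemma Ealg_univ : exists phi : {lrmorphism A -> B},
  [/\ forall f, phi (Ecoeff f) = j f, phi etap = x, phi etam = y
    & phi delta = d].
Proof.
have phiD : zmod_morphism phi.
  move=> u v; rewrite /phi -sumrB; apply: eq_bigr => t _.
  by rewrite !ffunE /ev raddfB !mulrBl.
pose phi1 := GRing.isZmodMorphism.Build A B phi phiD.
pose phi_add : {additive A -> B} := HB.pack phi phi1.
have phiM : monoid_morphism phi.
  split=> [|u v].
    by rewrite phi_mon /ev rmorph1 !expr0 !mulr1.
  rewrite (Ealg_monE u) (Ealg_monE v) mulr_suml -[phi]/(phi_add : A -> B).
  rewrite !raddf_sum mulr_suml; apply: eq_bigr => s _.
  rewrite mulr_sumr !raddf_sum mulr_sumr; apply: eq_bigr => w _.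
  by rewrite EmonM /= !phi_mon ev_mul.
have phiZ : scalable phi.
  move=> k u; rewrite /phi scaler_sumr; apply: eq_bigr => t _.
  by rewrite !ffunE /ev linearZ /= !scalerAl.
pose phi2 := GRing.isMonoidMorphism.Build A B phi phiM.
pose phi3 := GRing.isScalable.Build F A B *:%R phi phiZ.
pose psi : {lrmorphism A -> B} := HB.pack phi phi1 phi2 phi3.
exists psi; split => [f|||]; rewrite /= phi_mon /ev ?rmorph1;
  by rewrite ?expr0 ?expr1 ?mulr1 ?mul1r.
Qed.

End Ealg_universal.

End Ealg_ring.

Section smooth.
Variable R : realType.
Implicit Types (f g : R * R -> R) (z v : R * R).


(* Functions R^2 -> R whose partial derivatives of order at most k all exist and
   are continuous. *)
Fixpoint Ck (k : nat) (f : R * R -> R) : Prop :=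
  continuous f /\
  if k is k'.+1 then
    [/\ forall z, derivable f z (1, 0), forall z, derivable f z (0, 1),
        Ck k' (fun z => 'D_((1 : R), (0 : R)) f z)
      & Ck k' (fun z => 'D_((0 : R), (1 : R)) f z)]
  else True.

Definition csmooth : {pred R * R -> R[i]} := [pred h : R * R -> R[i] |
  `[< forall k, Ck k (fun z => complex.Re (h z)) /\ Ck k (fun z => complex.Im (h z)) >]].

Fact Ck_ext k f g : f =1 g -> Ck k f -> Ck k g.
Proof. by move=> /funext ->. Qed.

Fact Ck_le k f : Ck k.+1 f -> Ck k f.
Proof.
elim: k f => [|k IHk] f; first by case.
by case=> cf [d1 d2 h1 h2]; exact: (conj cf (And4 d1 d2 (IHk _ h1) (IHk _ h2))).
Qed.

Fact Ck_cst k (c : R) : Ck k (fun=> c).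
Proof.
have cc a : continuous (fun _ : R * R => a : R) by move=> z; apply: cvg_cst.
elim: k c => [|k IHk] c; split=> //.
split; try by move=> z; exact: derivable_cst.
- by apply: (@Ck_ext _ (fun=> 0)) => // z; rewrite derive_cst.
- by apply: (@Ck_ext _ (fun=> 0)) => // z; rewrite derive_cst.
Qed.

Fact CkD k f g : Ck k f -> Ck k g -> Ck k (fun z => f z + g z).
Proof.
elim: k f g => [|k IHk] f g [cf hf] [cg hg].
  by split=> // z; apply: cvgD; [apply: cf|apply: cg].
split; first by move=> z; apply: cvgD; [apply: cf|apply: cg].
case: hf hg => [f1 f2 F1 F2] [g1 g2 G1 G2].
split; try by move=> z; apply: derivableD.
- by apply: Ck_ext (IHk _ _ F1 G1) => z; rewrite deriveD.
- by apply: Ck_ext (IHk _ _ F2 G2) => z; rewrite deriveD.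
Qed.

Fact CkM k f g : Ck k f -> Ck k g -> Ck k (fun z => f z * g z).
Proof.
elim: k f g => [|k IHk] f g hf hg.
  case: hf hg => [cf _] [cg _].
  by split=> // z; apply: cvgM; [apply: cf|apply: cg].
have [kf kg] := (Ck_le hf, Ck_le hg).
case: hf hg => [cf [f1 f2 F1 F2]] [cg [g1 g2 G1 G2]].
split; first by move=> z; apply: cvgM; [apply: cf|apply: cg].
split; try by move=> z; apply: derivableM.
- apply: Ck_ext (CkD (IHk _ _ kf G1) (IHk _ _ kg F1)) => z.
  by rewrite deriveM.
- apply: Ck_ext (CkD (IHk _ _ kf G2) (IHk _ _ kg F2)) => z.
  by rewrite deriveM.
Qed.

Fact CkN k f : Ck k f -> Ck k (fun z => - f z).
Proof.
move=> hf; apply: Ck_ext (CkM (Ck_cst k (-1)) hf) => z.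
by rewrite mulN1r.
Qed.

Fact is_derive_line f z v (l : R) :
  is_derive (0 : R) (1 : R) (fun t : R => f (t *: v + z)) l -> is_derive z v f l.
Proof.
have quotE : (fun h : R => h^-1 *: ((f \o shift z) (h *: v) - f z)) =
    (fun h : R => h^-1 *: (((fun t : R => f (t *: v + z)) \o shift 0) (h *: 1)
       - f (0 *: v + z))).
  apply/funext => h /=; rewrite scale0r add0r; congr (_ *: (f (_ *: v + z) - _)).
  by rewrite addr0 /GRing.scale /= mulr1.
case=> dl vl; split; first by rewrite /derivable quotE.
by rewrite /derive quotE.
Qed.

Fact is_derive_aff (k c t : R) : is_derive t 1 (fun t : R => t * k + c) k.
Proof.
have h : is_derive t (1 : R) (k \*: id + cst c) (k *: (1 : R) + 0).
  by apply: is_deriveD.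
rewrite addr0 /GRing.scale /= mulr1 in h.
by rewrite (_ : (fun _ => _) = k \*: id + cst c)// funeqE => u /=; rewrite mulrC.
Qed.

Fact is_derive_lin (a b : R) z v :
  is_derive z v (fun z => a * z.1 + b * z.2) (a * v.1 + b * v.2).
Proof.
apply: is_derive_line; have := is_derive_aff (a * v.1 + b * v.2) (a * z.1 + b * z.2) 0.
congr (is_derive _ _ _ _); apply/funext => t /=.
by rewrite /GRing.scale /=; ring.
Qed.

Fact is_derive_trig (a b c d : R) z v :
  is_derive z v
    (fun z => c * cos (a * z.1 + b * z.2) + d * sin (a * z.1 + b * z.2))
    ((a * v.1 + b * v.2) * d * cos (a * z.1 + b * z.2)
     + - ((a * v.1 + b * v.2) * c) * sin (a * z.1 + b * z.2)).
Proof.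
apply: is_derive_line.
set m := a * v.1 + b * v.2; set th := a * z.1 + b * z.2.
have da := is_derive_aff m th 0.
have dc : is_derive (0 : R) 1 (cos \o (fun t : R => t * m + th))
    (- sin (0 * m + th) * m) by exact: is_derive1_comp.
have ds : is_derive (0 : R) 1 (sin \o (fun t : R => t * m + th))
    (cos (0 * m + th) * m) by exact: is_derive1_comp.
have h := is_deriveD (is_deriveZ c dc) (is_deriveZ d ds).
have -> : (fun t : R => c * cos (a * (t *: v + z).1 + b * (t *: v + z).2)
    + d * sin (a * (t *: v + z).1 + b * (t *: v + z).2)) =
    c \*: (cos \o (fun t : R => t * m + th)) +
    d \*: (sin \o (fun t : R => t * m + th)).
  apply/funext => t; rewrite /GRing.scale /=.
  have -> : a * (t *: v + z).1 + b * (t *: v + z).2 = t * m + th.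
    by rewrite /m /th /= /GRing.scale /=; ring.
  by [].
apply: is_derive_eq h _.
by rewrite /GRing.scale /= mul0r add0r; ring.
Qed.

Fact continuous_lin (a b : R) : continuous (fun z : R * R => a * z.1 + b * z.2).
Proof.
move=> z; apply: cvgD; apply: cvgM; try exact: cvg_cst.
  exact: cvg_fst.
exact: cvg_snd.
Qed.

Fact Ck_lin k (a b : R) : Ck k (fun z => a * z.1 + b * z.2).
Proof.
case: k => [|k]; split; try exact: continuous_lin; try by [].
split.
- by move=> z; have [] := is_derive_lin a b z (1, 0).
- by move=> z; have [] := is_derive_lin a b z (0, 1).
- apply: Ck_ext (Ck_cst k a) => z.
  by have [_ ->] := is_derive_lin a b z (1, 0); rewrite /= mulr1 mulr0 addr0.
- apply: Ck_ext (Ck_cst k b) => z.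
  by have [_ ->] := is_derive_lin a b z (0, 1); rewrite /= mulr1 mulr0 add0r.
Qed.

Fact Ck_trig k (a b c d : R) :
  Ck k (fun z => c * cos (a * z.1 + b * z.2) + d * sin (a * z.1 + b * z.2)).
Proof.
have ct c' d' : continuous (fun z : R * R =>
    c' * cos (a * z.1 + b * z.2) + d' * sin (a * z.1 + b * z.2)).
  move=> z; apply: cvgD; apply: cvgM; try exact: cvg_cst.
    apply: (@continuous_comp _ _ _ (fun z : R * R => a * z.1 + b * z.2) cos z).
      exact: continuous_lin.
    exact: continuous_cos.
  apply: (@continuous_comp _ _ _ (fun z : R * R => a * z.1 + b * z.2) sin z).
    exact: continuous_lin.
  exact: continuous_sin.
elim: k c d => [|k IHk] c d; split; try exact: ct; try by [].
split.
- by move=> z; have [] := is_derive_trig a b c d z (1, 0).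
- by move=> z; have [] := is_derive_trig a b c d z (0, 1).
- apply: Ck_ext (IHk (a * d) (- (a * c))) => z.
  have [_ ->] := is_derive_trig a b c d z (1, 0).
  by rewrite /= mulr1 mulr0 addr0.
- apply: Ck_ext (IHk (b * d) (- (b * c))) => z.
  have [_ ->] := is_derive_trig a b c d z (0, 1).
  by rewrite /= mulr1 mulr0 add0r.
Qed.

Fact csmooth_subring : subring_closed csmooth.
Proof.
split=> [|f g /asboolP hf /asboolP hg|f g /asboolP hf /asboolP hg];
  apply/asboolP => k.
- by split; exact: Ck_cst.
- case: (hf k) (hg k) => [f1 f2] [g1 g2]; split.
    by apply: Ck_ext (CkD f1 (CkN g1)) => z /=; rewrite raddfB.
  by apply: Ck_ext (CkD f2 (CkN g2)) => z /=; rewrite raddfB.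
case: (hf k) (hg k) => [f1 f2] [g1 g2]; split.
  apply: Ck_ext (CkD (CkM f1 g1) (CkN (CkM f2 g2))) => z /=.
  by rewrite /GRing.mul /=; case: (f z) => ? ?; case: (g z).
apply: Ck_ext (CkD (CkM f1 g2) (CkM f2 g1)) => z /=.
by rewrite /GRing.mul /=; case: (f z) => ? ?; case: (g z).
Qed.

HB.instance Definition _ :=
  GRing.isSubringClosed.Build (R * R -> R[i])%type csmooth csmooth_subring.

(* C^oo(R^2): complex-valued smooth functions of z = (z_+, z_-). *)
Record Cinf := MkCinf { Cinf_fun :> R * R -> R[i]; _ : Cinf_fun \in csmooth }.

HB.instance Definition _ := [isSub of Cinf for Cinf_fun].
HB.instance Definition _ := [Choice of Cinf by <:].
HB.instance Definition _ := [SubChoice_isSubComNzRing of Cinf by <:].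

Lemma Cinf_ext (f g : Cinf) : f =1 g -> f = g.
Proof. by move=> fg; apply/val_inj/funext. Qed.

Fact csmooth_cst (c : R[i]) : (fun=> c) \in csmooth.
Proof. by apply/asboolP => k; split; exact: Ck_cst. Qed.

Definition Cinf_cst (c : R[i]) : Cinf := MkCinf (csmooth_cst c).

Definition Cinf_scale (c : R[i]) (f : Cinf) : Cinf := Cinf_cst c * f.

Fact Cinf_scaleA (a b : R[i]) (f : Cinf) : Cinf_scale a (Cinf_scale b f) = Cinf_scale (a * b) f.
Proof. by apply: Cinf_ext => z; exact: mulrA. Qed.

Fact Cinf_scale1 : left_id 1 Cinf_scale.
Proof. by move=> f; apply: Cinf_ext => z; exact: mul1r. Qed.

Fact Cinf_scaleDr : right_distributive Cinf_scale +%R.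
Proof. by move=> a f g; apply: Cinf_ext => z; exact: mulrDr. Qed.

Fact Cinf_scaleDl (f : Cinf) : {morph Cinf_scale^~ f : a b / a + b}.
Proof. by move=> a b; apply: Cinf_ext => z; exact: mulrDl. Qed.

HB.instance Definition _ := GRing.Zmodule_isLmodule.Build R[i] Cinf
  Cinf_scaleA Cinf_scale1 Cinf_scaleDr Cinf_scaleDl.

Fact Cinf_scaleAl (a : R[i]) (f g : Cinf) : a *: (f * g) = (a *: f) * g.
Proof. exact: mulrA. Qed.

HB.instance Definition _ :=
  GRing.Lmodule_isLalgebra.Build R[i] Cinf Cinf_scaleAl.
HB.instance Definition _ := GRing.Lalgebra_isComAlgebra.Build R[i] Cinf.

Fact csmooth_conj (f : Cinf) : (fun z => conjc (f z)) \in csmooth.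
Proof.
have /asboolP hf := valP f; apply/asboolP => k; have [f1 f2] := hf k.
split; first by apply: Ck_ext f1 => z /=; case: (f z).
by apply: Ck_ext (CkN f2) => z /=; case: (f z).
Qed.

Definition Cinf_conj (f : Cinf) : Cinf := MkCinf (csmooth_conj f).

Fact Cinf_conj_zmod : zmod_morphism Cinf_conj.
Proof. by move=> f g; apply: Cinf_ext => z; exact: (rmorphB conjc). Qed.

Fact Cinf_conj_monoid : monoid_morphism Cinf_conj.
Proof.
split=> [|f g]; apply: Cinf_ext => z; first exact: (rmorph1 conjc).
exact: (rmorphM conjc).
Qed.

HB.instance Definition _ :=
  GRing.isZmodMorphism.Build Cinf Cinf Cinf_conj Cinf_conj_zmod.
HB.instance Definition _ :=
  GRing.isMonoidMorphism.Build Cinf Cinf Cinf_conj Cinf_conj_monoid.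

Lemma Cinf_conjZ (c : R[i]) (f : Cinf) :
  Cinf_conj (c *: f) = conjc c *: Cinf_conj f.
Proof. by apply: Cinf_ext => z; exact: (rmorphM conjc). Qed.

Fact csmooth_lin (a b : R) : (fun z : R * R => (a * z.1 + b * z.2)%:C) \in csmooth.
Proof. by apply/asboolP => k; split; [exact: Ck_lin|exact: Ck_cst]. Qed.

Fact csmooth_zp : (fun z : R * R => z.1%:C) \in csmooth.
Proof.
by have := csmooth_lin 1 0; under eq_fun do rewrite mul1r mul0r addr0.
Qed.

Fact csmooth_zm : (fun z : R * R => z.2%:C) \in csmooth.
Proof.
by have := csmooth_lin 0 1; under eq_fun do rewrite mul1r mul0r add0r.
Qed.

Definition zp : Cinf := MkCinf csmooth_zp.
Definition zm : Cinf := MkCinf csmooth_zm.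

Fact csmooth_wave (a b : R) : (fun z : R * R =>
  cos (a * z.1 + b * z.2) +i* sin (a * z.1 + b * z.2)) \in csmooth.
Proof.
apply/asboolP => k; split.
  by apply: Ck_ext (Ck_trig k a b 1 0) => z /=; rewrite mul1r mul0r addr0.
by apply: Ck_ext (Ck_trig k a b 0 1) => z /=; rewrite mul1r mul0r add0r.
Qed.

(* e^(i (a z_+ + b z_-)) *)
Definition wave (a b : R) : Cinf := MkCinf (csmooth_wave a b).

End smooth.

Section Eq11.
Context {R : realType} {p : nat} {q : R[i]}.
Variable hq : p.-primitive_root q.

Local Notation Aq := (Ealg (Cinf R) hq).

(* The involution: the antilinear extension of
   (f eta_+^a eta_-^b delta^c)^* = conj(f) delta^c eta_-^b eta_+^a; it is
   antimultiplicative by [starM]. *)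
Definition star (x : Aq) : Aq :=
  \sum_(t : 'I_p * 'I_p * 'I_p) Ecoeff hq (Cinf_conj (x t)) *
    delta hq ^+ t.2 * etam hq ^+ t.1.2 * etap hq ^+ t.1.1.


(* A(SO(1,1|p)) is identified with 'cV[R[i]]_p through its basis
   delta^0, ..., delta^(p-1); [dl m] is delta^m, for any m since delta^p = 1. *)
Definition dl (m : nat) : 'cV[R[i]]_p := \col_i (i == (m %% p)%N :> nat)%:R.

Definition SOmul (a b : 'cV[R[i]]_p) : 'cV[R[i]]_p :=
  \sum_(i < p) \sum_(j < p) (a i 0 * b j 0) *: dl (i + j).

Definition SOstar (a : 'cV[R[i]]_p) : 'cV[R[i]]_p := map_mx conjc a.

Definition SOint (a : 'cV[R[i]]_p) : R[i] := \sum_(m < p) a m 0 * (p %| m)%N%:R.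

Definition SOform (a b : 'cV[R[i]]_p) : R[i] := SOint (SOmul (SOstar a) b).

(* Elements of A(SO(1,1|p)) (x) A(E_q(1,1)) are columns over A(E_q(1,1)),
   operators in End(A(SO(1,1|p))) (x) A(E_q(1,1)) are square matrices over
   A(E_q(1,1)), and [tens X F] is X (x) F in either case.  The product of such
   matrices lets the second factors act by left multiplication. *)
Definition tens {m n} (X : 'M[R[i]]_(m, n)) (F : Aq) : 'M[Aq]_(m, n) :=
  \matrix_(i, j) (X i j *: F).

(* The form {a (x) F, b (x) G}_S = F^* G (a, b)_S, see [Sform_tens]. *)
Definition Sform (u v : 'cV[Aq]_p) : Aq :=
  \sum_(i < p) \sum_(j < p) SOform (dl i) (dl j) *: (star (u i 0) * v j 0).

(* E is the sum of the series of the X^k / k!, which is required to converge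
   coefficientwise on the monomials eta_+^a eta_-^b delta^c (index t) and
   pointwise in z = (z_+, z_-). *)
Definition is_exp {n} (X E : 'M[Aq]_n) : Prop := forall i j t z,
  (fun N => \sum_(k < N) (k`!%:R)^-1 * (X ^+ k) i j t z : R[i]^o) @ \oo
    --> (E i j t z : R[i]^o).

(* Meaningful only when the exponential series of X converges. *)
Definition mexp {n} (X : 'M[Aq]_n) : 'M[Aq]_n := xget 0 [set E | is_exp X E].

Lemma is_exp_uniq {n} (X E E' : 'M[Aq]_n) : is_exp X E -> is_exp X E' -> E = E'.
Proof.
move=> hE hE'; apply/matrixP => i j; apply/ffunP => t; apply: Cinf_ext => z.
exact: (cvg_unique _ (hE i j t z) (hE' i j t z)).
Qed.


Fact conj_q : conjc q = q^-1.
Proof.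
have p0 : (0 < p)%N by exact: prim_order_gt0 hq.
have q0 : q != 0 by rewrite (prim_root_eq0 hq) -lt0n.
have nq : `|q| = 1.
  by apply/eqP; rewrite -(@pexpr_eq1 _ _ p)// -normrX (prim_expr_order hq) normr1.
by apply: (mulfI q0); rewrite divff// -sqr_normc nq expr1n.
Qed.

Fact starD x y : star (x + y) = star x + star y.
Proof.
rewrite /star -big_split; apply: eq_bigr => t _.
by rewrite ffunE raddfD raddfD !mulrDl.
Qed.

Fact star0 : star 0 = 0.
Proof. by rewrite /star big1// => t _; rewrite ffunE !raddf0 !mul0r. Qed.

Fact star_sum I (r : seq I) (f : I -> Aq) :
  star (\sum_(i <- r) f i) = \sum_(i <- r) star (f i).
Proof. exact: (big_morph star starD star0). Qed.

Fact starZ (c : R[i]) x : star (c *: x) = conjc c *: star x.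
Proof.
rewrite /star scaler_sumr; apply: eq_bigr => t _.
by rewrite ffunE Cinf_conjZ linearZ -!scalerAl.
Qed.

Let S (a b c : nat) : R[i] :=
  (q ^- c) ^+ (2 * b) * (q ^+ (2 * (b * a)) * (q ^- c) ^+ (2 * a)).

Fact Emon_rev (f : Cinf R) (a b c : nat) :
  Ecoeff hq f * delta hq ^+ c * etam hq ^+ b * etap hq ^+ a =
  S a b c *: Emon hq f a b c.
Proof.
rewrite etapX etamX deltaX /Ecoeff !EmonM !mulr1 -EmonZ.
congr (Emon hq _ _ _ _); rewrite ?addn0 //.
rewrite !scalerA /S /Ecoef !mul0n !muln0 !expr0 !mulr1 !mul1r.
by rewrite !add0n addn0 mulrC.
Qed.

Fact star_mon (f : Cinf R) (a b c : nat) :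
  star (Emon hq f a b c) =
  Ecoeff hq (Cinf_conj f) * delta hq ^+ c * etam hq ^+ b * etap hq ^+ a.
Proof.
have [pa|pa] := leqP p a; first by rewrite etapX !Emon_geA// star0 mulr0.
have [pb|pb] := leqP p b.
  by rewrite etamX !Emon_geB// star0 mulr0 mul0r.
have pc : (c %% p < p)%N by rewrite ltn_mod (prim_order_gt0 hq).
rewrite /star (bigD1 (Ordinal pa, Ordinal pb, Ordinal pc))//= big1 ?addr0.
  by rewrite ffunE /= !eqxx !deltaX Emon_mod.
move=> [[a' b'] c'] ne_t; rewrite ffunE/=; case: ifP => [/and3P[]|_].
  move=> /eqP ea /eqP eb /eqP ec; case/negP: ne_t; apply/eqP.
  by congr (_, _, _); apply/val_inj.
by rewrite !raddf0 !mul0r.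
Qed.

Lemma star_etap : star (etap hq) = etap hq.
Proof.
rewrite star_mon Emon_rev /S ?mul0n !muln0 !expr0 invr1 !expr1n.
by rewrite ?mulr1 scale1r rmorph1.
Qed.

Lemma star_etam : star (etam hq) = etam hq.
Proof.
rewrite star_mon Emon_rev /S ?mul0n !muln0 !expr0 invr1 !expr1n.
by rewrite ?mulr1 scale1r rmorph1.
Qed.

Lemma star_delta : star (delta hq) = delta hq.
Proof.
by rewrite star_mon Emon_rev /S !muln0 !expr0 !mulr1 scale1r rmorph1.
Qed.

Lemma star_coeff (f : Cinf R) : star (Ecoeff hq f) = Ecoeff hq (Cinf_conj f).
Proof. by rewrite star_mon !expr0 !mulr1. Qed.

Fact star_monM (f g : Cinf R) (a b c a' b' c' : nat) :
  star (Emon hq f a b c * Emon hq g a' b' c') =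
  star (Emon hq g a' b' c') * star (Emon hq f a b c).
Proof.
have q0 : q != 0 by rewrite (prim_root_eq0 hq) -lt0n (prim_order_gt0 hq).
have qV n : q ^+ n * q^-1 ^+ n = 1 by rewrite exprVn divff// expf_neq0.
have key A B A' B' : (A + B' = A' + B)%N ->
    q^-1 ^+ A * q ^+ B = q^-1 ^+ A' * q ^+ B'.
  move=> AB; have nz : q ^+ (A + A') != 0 by rewrite expf_neq0.
  apply: (mulfI nz); rewrite !exprD [LHS]mulrACA qV mul1r -(exprD q A' B) -AB.
  by rewrite (mulrC (q ^+ A)) [RHS]mulrACA qV mul1r exprD.
have conjE : conjc (@Ecoef _ q b c a' b') =
    q^-1 ^+ (2 * (b * a')) * q ^+ (c * (2 * (a' + b'))).
  by rewrite /Ecoef -!exprVn -exprM (rmorphM conjc) !(rmorphXn conjc) /= fmorphV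
    /= conj_q invrK.
rewrite EmonM !star_mon !Emon_rev -!scalerAl -!scalerAr EmonM -!EmonZ.
rewrite Cinf_conjZ conjE (rmorphM (@Cinf_conj R)) !scalerA.
rewrite (addnC a) (addnC b) (addnC c) (mulrC (Cinf_conj f)).
congr (Emon hq (_ *: _) _ _ _).
pose A := (((c' + c) * (2 * (b' + b)) + (c' + c) * (2 * (a' + a)))
  + 2 * (b * a'))%N.
pose B := (2 * ((b' + b) * (a' + a)) + c * (2 * (a' + b')))%N.
pose A' := (c' * (2 * b') + c' * (2 * a') + (c * (2 * b) + c * (2 * a))
  + c' * (2 * (a + b)))%N.
pose B' := (2 * (b' * a') + 2 * (b * a) + 2 * (b' * a))%N.
transitivity (q^-1 ^+ A * q ^+ B).
  by rewrite /S /A /B -!exprVn -!exprM !exprD; ring.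
transitivity (q^-1 ^+ A' * q ^+ B').
  by apply: key; rewrite /A /B /A' /B'; lia.
by rewrite /S /A' /B' /Ecoef -!exprVn -!exprM !exprD; ring.
Qed.

Lemma starM x y : star (x * y) = star y * star x.
Proof.
rewrite (Ealg_monE x) (Ealg_monE y) mulr_suml !star_sum mulr_sumr.
apply: eq_bigr => s _; rewrite mulr_sumr star_sum mulr_suml.
by apply: eq_bigr => u _; rewrite star_monM.
Qed.

Lemma Sform_tens (a b : 'cV[R[i]]_p) (F G : Aq) :
  Sform (tens a F) (tens b G) = SOform a b *: (star F * G).
Proof.
have dlE (c : 'cV[R[i]]_p) : c = \sum_(i < p) c i 0 *: dl i.
  apply/matrixP => i j; rewrite ord1 summxE (bigD1 i)//= big1 => [|k ne_k].
    by rewrite !mxE modn_small// eqxx mulr1 addr0.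
  by rewrite !mxE modn_small// (inj_eq val_inj) eq_sym (negPf ne_k) mulr0.
pose e (i j : 'I_p) := SOint (dl (i + j)).
have formE (c d : 'cV[R[i]]_p) :
    SOform c d = \sum_(i < p) \sum_(j < p) conjc (c i 0) * d j 0 * e i j.
  rewrite /SOform /SOint /SOmul.
  under eq_bigr do rewrite summxE mulr_suml.
  rewrite exchange_big; apply: eq_bigr => i _ /=.
  under eq_bigr do rewrite summxE mulr_suml.
  rewrite exchange_big; apply: eq_bigr => j _ /=.
  by rewrite /e /SOint mulr_sumr; apply: eq_bigr => k _; rewrite !mxE mulrA.
have form_dl (i j : 'I_p) : SOform (dl i) (dl j) = e i j.
  rewrite formE (bigD1 i)//= [X in _ + X]big1 ?addr0 => [|k ne_k].
    rewrite (bigD1 j)//= [X in _ + X]big1 ?addr0 => [|k ne_k].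
      by rewrite !mxE !modn_small// !eqxx rmorph1 !mul1r.
    by rewrite !mxE !modn_small// !(inj_eq val_inj) (negPf ne_k) mulr0 mul0r.
  apply: big1 => l _; rewrite !mxE !modn_small// (inj_eq val_inj) (negPf ne_k).
  by rewrite rmorph0 !mul0r.
rewrite /Sform formE scaler_suml; apply: eq_bigr => i _.
rewrite scaler_suml; apply: eq_bigr => j _; rewrite form_dl !mxE.
by rewrite starZ -scalerAl -scalerAr !scalerA -mulrA mulrC.
Qed.


(* A representation on C^n of the algebra U_q(e(1,1)) presented by p_+, p_- and
   kappa, given by the images of the generators. *)
Record Uq_rep (n : nat) := MkUqRep {
  rep_pp : 'M[R[i]]_n;
  rep_pm : 'M[R[i]]_n;
  rep_kappa : 'M[R[i]]_n;
  rep_pp_pm : rep_pp * rep_pm = rep_pm * rep_pp;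
  rep_pp_kappa : rep_pp * rep_kappa = q^-1 *: (rep_kappa * rep_pp);
  rep_pm_kappa : rep_pm * rep_kappa = q *: (rep_kappa * rep_pm);
  rep_kappaXp : rep_kappa ^+ p = 1 }.

Definition rep_Pp n (L : Uq_rep n) : 'M[R[i]]_n := rep_pp L ^+ p.
Definition rep_Pm n (L : Uq_rep n) : 'M[R[i]]_n := rep_pm L ^+ p.

(* epsilon_(+-) = - q^(-+1/2) p_(+-) kappa^-1, where r stands for q^(1/2). *)
Definition rep_epsp (r : R[i]) n (L : Uq_rep n) : 'M[R[i]]_n :=
  - r^-1 *: (rep_pp L * invmx (rep_kappa L)).
Definition rep_epsm (r : R[i]) n (L : Uq_rep n) : 'M[R[i]]_n :=
  - r *: (rep_pm L * invmx (rep_kappa L)).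

Lemma dlE (m : nat) (i : 'I_p) : dl m i 0 = (i == (m %% p)%N :> nat)%:R.
Proof. by rewrite mxE. Qed.

Lemma dl_mod m : dl (m %% p)%N = dl m.
Proof. by apply/matrixP => i j; rewrite !mxE modn_mod. Qed.

(* L^lambda(p_+), L^lambda(p_-), L^lambda(kappa): column j is the image of
   delta^j, and delta^(j-1) = delta^(j+p-1). *)
Definition Lpp (lp : R) : 'M[R[i]]_p := \matrix_(i, j) (lp%:C *: dl j.+1) i 0.
Definition Lpm (lm : R) : 'M[R[i]]_p :=
  \matrix_(i, j) (lm%:C *: dl (j + p.-1)) i 0.
Definition Lkappa : 'M[R[i]]_p := \matrix_(i, j) (q ^+ j *: dl j) i 0.

Fact col_dl (f : nat -> 'cV[R[i]]_p) m : f (m %% p)%N = f m ->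
  (\matrix_(i, j < p) f j i 0) *m dl m = f m.
Proof.
have pm : (m %% p < p)%N by rewrite ltn_mod (p_gt0 hq).
move=> fm; apply/matrixP => i k; rewrite !mxE (bigD1 (Ordinal pm))//= big1.
  by rewrite !mxE /= eqxx mulr1 addr0 fm ord1.
move=> j ne_j; rewrite !mxE; case: eqP => [e|]; last by rewrite mulr0.
by case/negP: ne_j; apply/eqP/val_inj.
Qed.

Lemma Lpp_dl lp m : Lpp lp *m dl m = lp%:C *: dl m.+1.
Proof.
apply: (col_dl (f := fun m => lp%:C *: dl m.+1)).
congr (_ *: _); rewrite -dl_mod -[RHS]dl_mod; congr dl.
by rewrite -addn1 modnDml addn1.
Qed.

Lemma Lpm_dl lm m : Lpm lm *m dl m = lm%:C *: dl (m + p.-1).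
Proof.
rewrite (col_dl (f := fun m => lm%:C *: dl (m + p.-1)))//.
by congr (_ *: _); rewrite -dl_mod modnDml dl_mod.
Qed.

Lemma Lkappa_dl m : Lkappa *m dl m = q ^+ m *: dl m.
Proof.
by apply: (col_dl (f := fun m => q ^+ m *: dl m)); rewrite dl_mod (prim_expr_mod hq).
Qed.

Fact SO_ext (X Y : 'M[R[i]]_p) : (forall m, X *m dl m = Y *m dl m) -> X = Y.
Proof.
move=> XY; apply/matrixP => i j; have /matrixP /(_ i 0) := XY j.
have pick (Z : 'M[R[i]]_p) : (Z *m dl j) i 0 = Z i j.
  rewrite mxE (bigD1 j)//= big1 => [|k ne_k]; rewrite !mxE modn_small//.
    by rewrite eqxx mulr1 addr0.
  by rewrite (inj_eq val_inj) (negPf ne_k) mulr0.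
by rewrite !pick.
Qed.

Fact Lppm lp lm : Lpp lp * Lpm lm = Lpm lm * Lpp lp.
Proof.
apply: SO_ext => m; rewrite -!mulmxE -!mulmxA Lpp_dl Lpm_dl -!scalemxAr.
by rewrite Lpp_dl Lpm_dl !scalerA mulrC addSn.
Qed.

Fact Lppk lp : Lpp lp * Lkappa = q^-1 *: (Lkappa * Lpp lp).
Proof.
have q0 : q != 0 by rewrite (prim_root_eq0 hq) -lt0n (p_gt0 hq).
apply: SO_ext => m; rewrite -!mulmxE -scalemxAl -!mulmxA Lpp_dl Lkappa_dl.
rewrite -!scalemxAr Lpp_dl Lkappa_dl !scalerA; congr (_ *: _).
by rewrite -!mulrA exprS mulrCA mulKf// mulrC.
Qed.

Fact Lpmk lm : Lpm lm * Lkappa = q *: (Lkappa * Lpm lm).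
Proof.
apply: SO_ext => m; rewrite -!mulmxE -scalemxAl -!mulmxA Lpm_dl Lkappa_dl.
rewrite -!scalemxAr Lpm_dl Lkappa_dl !scalerA; congr (_ *: _).
rewrite -!mulrA mulrCA -exprS -addnS prednK ?(p_gt0 hq)// exprD.
by rewrite (prim_expr_order hq) mulr1 mulrC.
Qed.

Fact LkappaXp : Lkappa ^+ p = 1.
Proof.
apply: SO_ext => m.
have LX k : Lkappa ^+ k *m dl m = q ^+ (m * k) *: dl m.
  elim: k => [|k IHk]; first by rewrite muln0 !expr0 mul1mx scale1r.
  by rewrite exprS -mulmxE -mulmxA IHk -scalemxAr Lkappa_dl scalerA mulnS exprD mulrC.
by rewrite LX mulnC exprM (prim_expr_order hq) expr1n scale1r mul1mx.
Qed.

Definition Llambda (lp lm : R) : Uq_rep p :=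
  MkUqRep (Lppm lp lm) (Lppk lp) (Lpmk lm) LkappaXp.

Definition qint (k : nat) : R[i] := (q ^+ k - q ^- k) / (q - q^-1).

Definition qfact (k : nat) : R[i] := \prod_(1 <= l < k.+1) qint l.

Definition cscale {n} (c : R[i]) (X : 'M[Aq]_n) : 'M[Aq]_n :=
  map_mx (fun x : Aq => c *: x) X.

Definition qexpp {n} (X : 'M[Aq]_n) : 'M[Aq]_n :=
  \sum_(m < p) cscale (q ^+ (m * m.-1)./2 / qfact m) (X ^+ m).

Definition qexpm {n} (X : 'M[Aq]_n) : 'M[Aq]_n :=
  \sum_(m < p) cscale (q ^- (m * m.-1)./2 / qfact m) (X ^+ m).

Definition Dtwist {n} (K : 'M[R[i]]_n) : 'M[Aq]_n :=
  cscale p%:R^-1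
    (\sum_(m < p) \sum_(k < p) tens (q ^- (m * k) *: K ^+ m) (delta hq ^+ k)).

Definition Tlambda (r : R[i]) (lp lm : R) (a : 'cV[R[i]]_p) : 'cV[Aq]_p :=
  let L := Llambda lp lm in
  mexp (tens (- 'i%C *: rep_Pp L) (Ecoeff hq (zp R))
        + tens (- 'i%C *: rep_Pm L) (Ecoeff hq (zm R)))
  *m qexpp (tens ('i%C *: rep_epsp r L) (etap hq))
  *m qexpm (tens ('i%C *: rep_epsm r L) (etam hq))
  *m Dtwist (rep_kappa L)
  *m tens a 1.

Definition Dlambda (r : R[i]) (lp lm : R) (m n : 'I_p) : Aq :=
  Sform (tens (dl (p - m)) 1) (Tlambda r lp lm (dl n)).

Definition xi : Aq := q *: (etap hq * etam hq).

End Eq11.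

Arguments Ecoef {F} q b c a' b'.
Arguments Uq_rep {R} p q n.
Arguments qint {R} q k.
Arguments qfact {R} q k.

(* Main.v *)
(** Since D (delta^n (x) 1) = delta^n (x) delta^n and the prefactors
    q^(+-m(m-1)/2) of e_(+-) cancel the powers of q produced by kappa^-1 in
    (epsilon_(+-))^m delta^n,
      T^lambda delta^n = e^(-i lambda_+^p z_+ - i lambda_-^p z_-)
        \sum_(a, b < p) (-i q^(-1/2-n+b) lambda_+)^a (-i q^(1/2-n) lambda_-)^b
          / ([a]! [b]!) delta^(n-b+a) (x) eta_+^a eta_-^b delta^n.
    The coefficient of delta^m collects the pairs with b = a + (n - m) mod p:
    either b = a + s or a = b + (p - s), with s the representative of n - m.
    Since xi^k = q^(k^2) eta_+^k eta_-^k, these are the two sums. *)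

Require Import Defs.
From HB Require Import structures.
From mathcomp Require Import all_boot all_order all_algebra.
From mathcomp Require Import complex.
From mathcomp Require Import all_classical all_reals all_analysis.
From mathcomp Require Import ring lra zify.

Set Implicit Arguments.
Unset Strict Implicit.
Unset Printing Implicit Defensive.

Import Order.TTheory GRing.Theory Num.Theory numFieldNormedType.Exports.

Local Open Scope ring_scope.
Local Open Scope complex_scope.

(** For each a exactly one b < p qualifies: a + s while a < p - s, and a - (p - s) from there on.
    Splitting the range of a at p - s gives the two sums. The case s = p must be covered: it occurs
    when m = n. *)
Lemma sum_modn_shift (V : nmodType) (p s : nat) (f : nat -> nat -> V) :
  (s <= p)%N ->
  \sum_(a < p) \sum_(b < p) (if (b == a + s %[mod p])%N then f a b else 0) =
  \sum_(k < p - s) f k (k + s)%N + \sum_(k < s) f (k + (p - s))%N k.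
Proof.
move=> le_sp.
rewrite -(big_mkord xpredT (fun a => \sum_(b < p)
  (if (b == a + s %[mod p])%N then f a b else 0))).
rewrite (big_cat_nat (n := (p - s)%N)) ?leq_subr//=; congr (_ + _).
  rewrite big_mkord; apply: eq_bigr => a _.
  have lt_p : (a + s < p)%N by have := ltn_ord a; lia.
  rewrite (bigD1 (Ordinal lt_p))//= eqxx big1 ?addr0// => b ne_b.
  by rewrite !modn_small// ifN// val_eqE.
rewrite -{1}[(p - s)%N]add0n big_addn subKn// big_mkord.
apply: eq_bigr => a _; have lt_p : (a < p)%N by exact: leq_trans le_sp.
have mod_a : (a + (p - s) + s = a %[mod p])%N.
  by rewrite -addnA subnK// modnDr.
rewrite (bigD1 (Ordinal lt_p))//= mod_a eqxx big1 ?addr0// => b ne_b.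
by rewrite !modn_small// ifN// val_eqE.
Qed.

(** * Convergence of the exponential series at an imaginary number *)

Section exponential.
Variable R : realType.

Lemma cvg_complex (u v : nat -> R) (a b : R) :
  (u @ \oo --> a)%classic -> (v @ \oo --> b)%classic ->
  ((fun N => u N +i* v N : R[i]^o) @ \oo --> (a +i* b : R[i]^o))%classic.
Proof.
move=> /cvgrPdist_lt ua /cvgrPdist_lt vb; apply/cvgrPdist_lt => -[e e'].
(* In the partial order of [R[i]] a positive radius has imaginary part 0, so each component can be
   kept within half of its real part. *)
rewrite ltcE /= => /andP[/eqP -> e0]; have e20 : 0 < e / 2 by rewrite divr_gt0.
near=> N.
have hu : `|a - u N| < e / 2 by near: N; exact: ua.
have hv : `|b - v N| < e / 2 by near: N; exact: vb.
have -> : a +i* b - (u N +i* v N) = (a - u N)%:C + 'i%C * (b - v N)%:C.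
  by apply/eqP; rewrite eq_complex /=; apply/andP; split; apply/eqP; ring.
apply: le_lt_trans (ler_normD _ _) _; rewrite normrM.
rewrite !normc_def /= !expr0n expr1n add0r !addr0 sqrtr1 mul1r !sqrtr_sqr.
rewrite -rmorphD ltcR /=; lra.
Unshelve. all: by end_near. Qed.

(** Even powers of i are signs, so a term is real for even k and purely imaginary for odd k;
    [cos_coeff] and [sin_coeff] vanish on the opposite parities. *)
Lemma cis_coeffE (x : R) k :
  (k`!%:R)^-1 * ('i%C * x%:C) ^+ k = cos_coeff x k +i* sin_coeff x k.
Proof.
have iX j : 'i%C ^+ j.*2 = ((-1) ^+ j)%:C :> R[i].
  by rewrite -mul2n exprM sqr_i rmorphXn rmorphN1.
have rE (c : R) : ('i%C * c%:C) = 0 +i* c.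
  by apply/eqP; rewrite eq_complex /=; apply/andP; split; apply/eqP; ring.
have -> : (k`!%:R)^-1 = ((k`!%:R)^-1)%:C :> R[i] by rewrite fmorphV rmorph_nat.
rewrite exprMn -rmorphXn /cos_coeff /sin_coeff -{2}(odd_double_half k).
rewrite /= -exprnP; case: (boolP (odd k)) => odd_k.
  rewrite exprS iX -mulrA -!rmorphM mulrCA -rmorphM rE.
  have -> : k.-1./2 = k./2 by rewrite -{1}(odd_double_half k) odd_k /= doubleK.
  by congr (_ +i* _) => /=; ring.
rewrite add0n iX -!rmorphM.
by congr (_ +i* _) => /=; ring.
Qed.

Lemma cvg_exp_imag (x : R) :
  ((fun N => \sum_(k < N) (k`!%:R)^-1 * ('i%C * x%:C) ^+ k : R[i]^o) @ \oo
    --> (cos x +i* sin x : R[i]^o))%classic.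
Proof.
have hc : (series (cos_coeff x) @ \oo --> cos x)%classic.
  by rewrite cos.unlock; exact: is_cvg_series_cos_coeff.
have hs : (series (sin_coeff x) @ \oo --> sin x)%classic.
  by rewrite sin.unlock; exact: is_cvg_series_sin_coeff.
rewrite [X in (X @ _ --> _)%classic](_ : _ =
  (fun N => series (cos_coeff x) N +i* series (sin_coeff x) N)).
  exact: cvg_complex hc hs.
apply/funext => N; rewrite /series /= !big_mkord.
elim: N => [|N IH]; first by rewrite !big_ord0.
by rewrite !big_ord_recr /= IH cis_coeffE.
Qed.

End exponential.

(** The exponent n - b + a - m is coded in [nat] with p - m for -m and b(p - 1) for -b; adding b + m
    leaves a + n up to a multiple of p. *)
Lemma addn_complement p m n a b : (m < p)%N ->
  (p - m + (n + b * p.-1 + a) + (b + m) = b.+1 * p + (a + n))%N.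
Proof.
case: p => // p' mp; rewrite /= mulnS; nia.
Qed.

Lemma mulmx_entry (S : pzSemiRingType) m n l (A : 'M[S]_(m, n))
    (B : 'M[S]_(n, l)) i j :
  (A *m B) i j = \sum_k A i k * B k j.
Proof. by rewrite mxE. Qed.

(** Serves to apply T^lambda to a basis vector: C is the factor e_-, which acts first and produces
    the sum over b; B is e_+, which adds the sum over a; A is the exponential in z. *)
Lemma mulmx3_sum (S : pzSemiRingType) k l m n s (A : 'M[S]_(k, l))
    (B : 'M[S]_(l, m)) (C : 'M[S]_(m, n)) (u : 'M[S]_(n, s)) (I J : finType)
    (v : I -> 'M[S]_(m, s)) (w : I -> J -> 'M[S]_(l, s)) :
  C *m u = \sum_b v b -> (forall b, B *m v b = \sum_a w b a) ->
  A *m B *m C *m u = \sum_b \sum_a A *m w b a.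
Proof.
move=> Cu Bv; rewrite -!mulmxA Cu !mulmx_sumr; apply: eq_bigr => b _.
by rewrite Bv mulmx_sumr.
Qed.

Lemma mulr_sum_mid (A : pzSemiRingType) n (w y z : A) (F : 'I_n -> A) :
  w * ((\sum_i F i) * y * z) = \sum_i w * (F i * y * z).
Proof. by rewrite !mulr_suml mulr_sumr. Qed.

Lemma mulr_sum_last (A : pzSemiRingType) n (w x : A) (F : 'I_n -> A) :
  w * (x * \sum_i F i) = \sum_i w * (x * F i).
Proof. by rewrite !mulr_sumr. Qed.

(** * Calculus of the tensors X (x) F *)

Section representation.
Variables (R : realType) (p : nat) (q : R[i]) (hq : p.-primitive_root q).
Local Notation Aq := (Ealg (Cinf R) hq).

Let q_neq0 : q != 0.
Proof. by rewrite (prim_root_eq0 hq) -lt0n (p_gt0 hq). Qed.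

Lemma tensM m n k (X : 'M[R[i]]_(m, n)) (Y : 'M[R[i]]_(n, k)) (F G : Aq) :
  tens X F *m tens Y G = tens (X *m Y) (F * G).
Proof.
apply/matrixP => i j; rewrite !mxE scaler_suml; apply: eq_bigr => l _.
by rewrite !mxE -scalerAl -scalerAr scalerA.
Qed.

Lemma tens1 n : tens (1 : 'M[R[i]]_n) (1 : Aq) = 1.
Proof. by apply/matrixP => i j; rewrite !mxE scaler_nat. Qed.

Lemma tensX n (X : 'M[R[i]]_n) (F : Aq) k :
  tens X F ^+ k = tens (X ^+ k) (F ^+ k).
Proof.
elim: k => [|k IHk]; first by rewrite !expr0 tens1.
by rewrite !exprS IHk -!mulmxE tensM.
Qed.

Lemma tensZ m n c (X : 'M[R[i]]_(m, n)) (F : Aq) :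
  tens (c *: X) F = tens X (c *: F).
Proof. by apply/matrixP => i j; rewrite !mxE scalerA mulrC. Qed.

Lemma tensDr m n (X : 'M[R[i]]_(m, n)) (F G : Aq) :
  tens X (F + G) = tens X F + tens X G.
Proof. by apply/matrixP => i j; rewrite !mxE scalerDr. Qed.

Lemma tens0r m n (X : 'M[R[i]]_(m, n)) : tens X (0 : Aq) = 0.
Proof. by apply/matrixP => i j; rewrite !mxE scaler0. Qed.

Lemma tens_sumr m n (X : 'M[R[i]]_(m, n)) I (s : seq I) (F : I -> Aq) :
  tens X (\sum_(i <- s) F i) = \sum_(i <- s) tens X (F i).
Proof. exact: (big_morph (tens X) (tensDr X) (tens0r X)). Qed.

Lemma cscaleM m n c (X : 'M[Aq]_n) (Y : 'M[R[i]]_(n, m)) (F : Aq) :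
  Defs.cscale c X *m tens Y F = X *m tens Y (c *: F).
Proof.
have cE i k : Defs.cscale c X i k = c *: X i k by exact: (mxE map_mx_key).
apply/matrixP => i j; rewrite [LHS]mulmx_entry [RHS]mulmx_entry.
apply: eq_bigr => k _; rewrite cE [tens Y F k j]mxE [tens Y _ k j]mxE.
by rewrite -scalerAl scalerAr !scalerA mulrC.
Qed.

Lemma qexpp_tens n m (X : 'M[R[i]]_n) (Y : 'M[R[i]]_(n, m)) (F G : Aq) :
  qexpp (tens X F) *m tens Y G = \sum_(k < p)
    tens (X ^+ k *m Y) ((q ^+ (k * k.-1)./2 / qfact q k) *: (F ^+ k * G)).
Proof.
rewrite mulmx_suml; apply: eq_bigr => k _.
by rewrite cscaleM tensX tensM scalerAr.
Qed.

Lemma qexpm_tens n m (X : 'M[R[i]]_n) (Y : 'M[R[i]]_(n, m)) (F G : Aq) :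
  qexpm (tens X F) *m tens Y G = \sum_(k < p)
    tens (X ^+ k *m Y) ((q ^- (k * k.-1)./2 / qfact q k) *: (F ^+ k * G)).
Proof.
rewrite mulmx_suml; apply: eq_bigr => k _.
by rewrite cscaleM tensX tensM scalerAr.
Qed.

(** * The exponential factor in z_+ and z_- *)

Lemma is_exp_tens1 n (f g : Cinf R) :
  (forall z, ((fun N => \sum_(k < N) (k`!%:R)^-1 * f z ^+ k : R[i]^o) @ \oo
    --> (g z : R[i]^o))%classic) ->
  is_exp (tens (1 : 'M[R[i]]_n) (Ecoeff hq f)) (tens 1 (Ecoeff hq g)).
Proof.
move=> fg i j t z.
(* The powers of 1 (x) f are 1 (x) f^k, supported on diagonal entries and on the monomial 1. The 0/1
   constant c records this support and reduces the claim to a scalar series at each z. *)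
pose c : R[i] := (1 : 'M[R[i]]_n) i j *
  [&& t.1.1 == 0 :> nat, t.1.2 == 0 :> nat & t.2 == 0 :> nat]%N%:R.
have fXE k : (f ^+ k) z = f z ^+ k.
  by elim: k => // k IHk; rewrite !exprS -IHk.
have tE (h : Cinf R) : tens (1 : 'M[R[i]]_n) (Ecoeff hq h) i j t z = c * h z.
  rewrite mxE !ffunE mod0n /c; case: ifP => _.
    by rewrite mulr1.
  by rewrite mulr0 mul0r scaler0.
rewrite tE (_ : (fun N => _) =
  (fun N => c * \sum_(k < N) (k`!%:R)^-1 * f z ^+ k)); last first.
  apply/funext => N; rewrite mulr_sumr; apply: eq_bigr => k _.
  by rewrite tensX expr1n -rmorphXn /= tE fXE mulrCA.
by apply: cvgM; [exact: cvg_cst|exact: fg].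
Qed.

(** Both operators are scalar, so the exponent is 1 (x) g for a single function g, with purely
    imaginary values because a and b are real. *)
Lemma mexp_wave n (a b : R) :
  mexp (tens (- 'i%C *: (a%:C *: (1 : 'M[R[i]]_n))) (Ecoeff hq (zp R))
    + tens (- 'i%C *: (b%:C *: (1 : 'M[R[i]]_n))) (Ecoeff hq (zm R)))
  = tens 1 (Ecoeff hq (wave (- a) (- b))).
Proof.
pose g : Cinf R := a%:C *: (- 'i%C *: zp R) + b%:C *: (- 'i%C *: zm R).
rewrite (_ : _ + _ = tens 1 (Ecoeff hq g)); last first.
  by rewrite !tensZ -tensDr /g /Ecoeff EmonD !EmonZ.
have gE z : g z = 'i%C * (- a * z.1 + - b * z.2)%:C.
  transitivity (a%:C * (- 'i%C * z.1%:C) + b%:C * (- 'i%C * z.2%:C)).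
    by [].
  by rewrite rmorphD !rmorphM !rmorphN /=; ring.
have hE : is_exp (tens (1 : 'M[R[i]]_n) (Ecoeff hq g))
    (tens 1 (Ecoeff hq (wave (- a) (- b)))).
  apply: is_exp_tens1 => z; rewrite gE; exact: cvg_exp_imag.
(* [mexp] is a choice with default 0: existence of an exponential rules out the default, and
   uniqueness of limits determines the choice. *)
by apply: xget_unique (hE) _ => E' hE'; exact: is_exp_uniq hE' hE.
Qed.

(** * Powers of the operators of L^lambda on the basis delta^m *)

Lemma dlDp m : dl (m + p)%N = dl m :> 'cV[R[i]]_p.
Proof. by rewrite -dl_mod modnDr dl_mod. Qed.

Lemma LppX (lp : R) k m :
  (Lpp lp : 'M[R[i]]_p) ^+ k *m dl m = lp%:C ^+ k *: dl (m + k)%N.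
Proof.
elim: k m => [|k IHk] m; first by rewrite !expr0 mul1mx scale1r addn0.
rewrite exprSr -mulmxE -mulmxA (Lpp_dl hq) -scalemxAr IHk scalerA -exprS.
by rewrite addSnnS.
Qed.

Lemma LpmX (lm : R) k m :
  (Lpm lm : 'M[R[i]]_p) ^+ k *m dl m = lm%:C ^+ k *: dl (m + k * p.-1)%N.
Proof.
elim: k m => [|k IHk] m; first by rewrite !expr0 mul1mx scale1r addn0.
rewrite exprSr -mulmxE -mulmxA (Lpm_dl hq) -scalemxAr IHk scalerA -exprS.
by rewrite mulSn addnA.
Qed.

Lemma rep_PpE lp lm :
  rep_Pp (Llambda hq lp lm) = (lp ^+ p)%:C *: (1 : 'M[R[i]]_p).
Proof.
apply: SO_ext => m; rewrite LppX dlDp -scalemxAl mul1mx.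
by rewrite rmorphXn.
Qed.

Lemma rep_PmE lp lm :
  rep_Pm (Llambda hq lp lm) = (lm ^+ p)%:C *: (1 : 'M[R[i]]_p).
Proof.
apply: SO_ext => m; rewrite LpmX -dl_mod addnC mulnC modnMDl dl_mod.
by rewrite -scalemxAl mul1mx rmorphXn.
Qed.

Lemma invLkappa_dl m : invmx (@Lkappa R p q) *m dl m = q ^- m *: dl m.
Proof.
have uK : (@Lkappa R p q) \in unitmx.
  have := LkappaXp hq; rewrite -(prednK (p_gt0 hq)) exprS -mulmxE.
  by case/mulmx1_unit.
have e : dl m = q ^- m *: ((@Lkappa R p q) *m dl m).
  by rewrite (Lkappa_dl hq) scalerA mulVf ?scale1r// expf_neq0.
by rewrite {1}e -scalemxAr mulKmx.
Qed.

(** Each application raises the exponent of delta by one, so the successive kappa^-1 contribute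
    q^-m, q^-(m+1), ..., with product q^(-am) q^(-a(a-1)/2). *)
Lemma epspX (r : R[i]) lp lm a m :
  ('i%C *: rep_epsp r (Llambda hq lp lm)) ^+ a *m dl m =
  ((- 'i%C * (r^-1 * q ^- m) * lp%:C) ^+ a * q ^- (a * a.-1)./2) *:
    dl (m + a)%N.
Proof.
(* As a binomial coefficient, a(a-1)/2 has its increment given by Pascal's rule. *)
rewrite -bin2; elim: a => [|a IHa].
  by rewrite !expr0 invr1 mulr1 mul1mx scale1r addn0.
rewrite exprS -mulmxE -mulmxA IHa -scalemxAr -!scalemxAl -mulmxA /=.
rewrite invLkappa_dl -!scalemxAr (Lpp_dl hq) !scalerA addnS; congr (_ *: _).
rewrite binS bin1 exprS !exprD !invfM; ring.
Qed.

(** Since q^p = 1, the summand c(p - 1) in an exponent stands for -c. *)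
Lemma exprV_shift k c : q ^- (k + c * p.-1) = q ^- k * q ^+ c.
Proof.
apply: (mulIf (expf_neq0 (k + c * p.-1) q_neq0)).
rewrite mulVf ?expf_neq0// mulrAC exprD mulKf ?expf_neq0// -exprD -mulnSr.
by rewrite prednK ?(p_gt0 hq)// mulnC exprM (prim_expr_order hq) expr1n.
Qed.

(** Here the exponent of delta decreases, so kappa^-1 contributes q^-m, q^-(m-1), ..., and the
    quadratic power of q has the opposite sign to that in [epspX]. *)
Lemma epsmX (r : R[i]) lp lm b m :
  ('i%C *: rep_epsm r (Llambda hq lp lm)) ^+ b *m dl m =
  ((- 'i%C * (r * q ^- m) * lm%:C) ^+ b * q ^+ (b * b.-1)./2) *:
    dl (m + b * p.-1)%N.
Proof.
rewrite -bin2; elim: b => [|b IHb].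
  by rewrite !expr0 mulr1 mul1mx scale1r addn0.
rewrite exprS -mulmxE -mulmxA IHb -scalemxAr -!scalemxAl -mulmxA /=.
rewrite invLkappa_dl -!scalemxAr (Lpm_dl hq) !scalerA mulSnr addnA.
congr (_ *: _); rewrite exprV_shift binS bin1 exprS !exprD; ring.
Qed.

(** * Action of the twist, the q-exponentials and T^lambda on the basis *)

Lemma Dtwist_dl (n : 'I_p) :
  Dtwist hq (@Lkappa R p q) *m tens (dl n) 1 = tens (dl n) (delta hq ^+ n).
Proof.
have p0 : p%:R != 0 :> R[i] by rewrite pnatr_eq0 -lt0n (p_gt0 hq).
have KX k : (@Lkappa R p q) ^+ k *m dl n = q ^+ (n * k) *: dl n.
  elim: k => [|k IHk]; first by rewrite muln0 !expr0 mul1mx scale1r.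
  by rewrite exprS -mulmxE -mulmxA IHk -scalemxAr (Lkappa_dl hq) scalerA mulnS
    exprD mulrC.
(* Orthogonality of the characters of Z/p: of all the powers delta^k in the twist only delta^n
   survives. *)
have sumE (k : 'I_p) :
    \sum_(m < p) q ^- (m * k) * q ^+ (n * m) = if k == n then p%:R else 0.
  pose x := q ^+ n / q ^+ k.
  have xE (m : 'I_p) : q ^- (m * k) * q ^+ (n * m) = x ^+ m.
    by rewrite mulrC exprM mulnC exprM -exprVn -exprMn.
  under eq_bigr do rewrite xE.
  case: eqVneq => [kn|ne_kn].
    rewrite (eq_bigr (fun=> 1)) ?sumr_const ?card_ord// => m _.
    by rewrite /x kn divff ?expf_neq0// expr1n.
  have x1 : x - 1 != 0.
    rewrite subr_eq0; apply: contra ne_kn => /eqP e.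
    have /eqP : q ^+ n = q ^+ k by rewrite -[RHS]mul1r -e divfK ?expf_neq0.
    by rewrite (eq_prim_root_expr hq) !modn_small// eq_sym.
  (* Geometric sum: multiplied by x - 1 it becomes x^p - 1 = 0, and x differs from 1 because q is
     primitive. *)
  apply: (mulfI x1); rewrite -subrX1 mulr0 /x exprMn exprVn -!exprM.
  by rewrite !(mulnC _ p) !exprM (prim_expr_order hq) !expr1n divr1 subrr.
rewrite cscaleM (_ : _ *m _ =
    tens (dl n) (\sum_(k < p) \sum_(m < p)
      (q ^- (m * k) * q ^+ (n * m) / p%:R) *: delta hq ^+ k)).
  congr (tens _ _); rewrite (bigD1 n)//= [X in _ + X]big1 => [|k ne_kn].
    by rewrite addr0 -scaler_suml -mulr_suml sumE eqxx mulfV// scale1r.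
  by rewrite -scaler_suml -mulr_suml sumE (negPf ne_kn) mul0r scale0r.
rewrite exchange_big tens_sumr mulmx_suml; apply: eq_bigr => m _ /=.
rewrite tens_sumr mulmx_suml; apply: eq_bigr => k _.
by rewrite tensM -scalemxAl KX scalerA tensZ -scalerAr mulr1 scalerA.
Qed.

Lemma qexpp_dl (r : R[i]) lp lm m (G : Aq) :
  qexpp (tens ('i%C *: rep_epsp r (Llambda hq lp lm)) (etap hq)) *m
    tens (dl m) G =
  \sum_(a < p) tens (dl (m + a)%N)
    (((- 'i%C * (r^-1 * q ^- m) * lp%:C) ^+ a / qfact q a) *:
       (etap hq ^+ a * G)).
Proof.
rewrite [LHS]qexpp_tens; apply: eq_bigr => a _.
rewrite epspX tensZ scalerA; congr (tens _ (_ *: _)).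
by rewrite mulrA divfK // expf_neq0.
Qed.

Lemma qexpm_dl (r : R[i]) lp lm m (G : Aq) :
  qexpm (tens ('i%C *: rep_epsm r (Llambda hq lp lm)) (etam hq)) *m
    tens (dl m) G =
  \sum_(b < p) tens (dl (m + b * p.-1)%N)
    (((- 'i%C * (r * q ^- m) * lm%:C) ^+ b / qfact q b) *:
       (etam hq ^+ b * G)).
Proof.
rewrite [LHS]qexpm_tens; apply: eq_bigr => b _.
rewrite epsmX tensZ scalerA; congr (tens _ (_ *: _)).
by rewrite mulrA mulfK // expf_neq0.
Qed.

(** The factor e_- acts before e_+, which therefore meets delta^(n-b) instead of delta^n; this is
    why the base of the a-th power depends on b. *)
Lemma Tlambda_dl (r : R[i]) lp lm (n : 'I_p) :
  Tlambda hq r lp lm (dl n) = \sum_(b < p) \sum_(a < p)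
    tens (dl (n + b * p.-1 + a)%N)
      (((- 'i%C * (r^-1 * q ^- (n + b * p.-1)) * lp%:C) ^+ a / qfact q a *
        ((- 'i%C * (r * q ^- n) * lm%:C) ^+ b / qfact q b)) *:
       Emon hq (wave (- lp ^+ p) (- lm ^+ p)) a b n).
Proof.
rewrite /Tlambda rep_PpE rep_PmE mexp_wave.
rewrite -[LHS]mulmxA Dtwist_dl.
rewrite [LHS](mulmx3_sum _ (qexpm_dl _ _ _ _ _) (fun b => qexpp_dl _ _ _ _ _)).
apply: eq_bigr => b _; apply: eq_bigr => a _.
rewrite [LHS]tensM mul1mx; congr (tens _ _).
by rewrite -!scalerAr scalerA EmonE !mulrA.
Qed.

(** * The form on basis elements and its additivity *)

Lemma SOform_dl i j : SOform (dl i : 'cV[R[i]]_p) (dl j) = (p %| i + j)%N%:R.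
Proof.
have p_gt := p_gt0 hq.
have starE : SOstar (dl i) = dl i :> 'cV[R[i]]_p.
  by apply/matrixP => k l; rewrite !mxE rmorph_nat.
pose o k : 'I_p := Ordinal (ltn_pmod k p_gt).
have dlo k (l : 'I_p) : (dl k : 'cV[R[i]]_p) l 0 = (l == o k)%:R by rewrite dlE.
have mulE : SOmul (dl i) (dl j) = dl (i + j)%N :> 'cV[R[i]]_p.
  rewrite /SOmul (bigD1 (o i))//= [X in _ + X]big1 ?addr0 => [|k ne_k].
    rewrite (bigD1 (o j))//= [X in _ + X]big1 ?addr0 => [|k ne_k].
      by rewrite !dlo !eqxx mulr1 scale1r -dl_mod modnDm dl_mod.
    by rewrite !dlo (negPf ne_k) mulr0 scale0r.
  by apply: big1 => l _; rewrite !dlo (negPf ne_k) mul0r scale0r.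
rewrite /SOform starE mulE /SOint (bigD1 (o (i + j)%N))//= big1 => [|k ne_k].
  by rewrite dlo eqxx mul1r addr0 /dvdn modn_mod.
by rewrite dlo (negPf ne_k) mul0r.
Qed.

Lemma SformDr (u v w : 'cV[Aq]_p) : Sform u (v + w) = Sform u v + Sform u w.
Proof.
rewrite /Sform -big_split; apply: eq_bigr => i _ /=.
rewrite -big_split; apply: eq_bigr => j _ /=.
by rewrite mxE mulrDr scalerDr.
Qed.

Lemma Sform0r (u : 'cV[Aq]_p) : Sform u 0 = 0.
Proof. by apply: (addrI (Sform u 0)); rewrite -SformDr !addr0. Qed.

Lemma Sform_sumr (u : 'cV[Aq]_p) I (s : seq I) (F : I -> 'cV[Aq]_p) :
  Sform u (\sum_(i <- s) F i) = \sum_(i <- s) Sform u (F i).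
Proof. exact: (big_morph (Sform u) (SformDr u) (Sform0r u)). Qed.

Lemma star1 : star (1 : Aq) = 1.
Proof. by rewrite -[1]/(Emon hq 1 0 0 0) star_mon rmorph1 !expr0 !mulr1. Qed.

(** * Matrix elements as sums of normally ordered monomials *)

Lemma xiX k : (xi hq) ^+ k = q ^+ (k * k) *: Emon hq 1 k k 0.
Proof.
elim: k => [|k IHk]; first by rewrite !expr0 scale1r.
rewrite exprS IHk /xi EmonM Ecoef00 muln0 expr0 scale1r mulr1.
rewrite -scalerAl -scalerAr EmonM Ecoef00 mulr1 !EmonZ !scalerA; congr (_ *: _).
(* Moving one eta_- past eta_+^k costs q^(2k), and xi carries one more q: k^2 + 2k + 1 = (k +
   1)^2. *)
by rewrite -exprS -exprD; congr (_ ^+ _); lia.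
Qed.

(** Pairing with delta^(p-m) keeps the terms with n - b + a = m mod p. The representative s of n - m
    is left free, so that each case of the theorem can use its own. *)
Lemma Dlambda_sum (r : R[i]) lp lm (m n : 'I_p) s :
  (s + m = n %[mod p])%N ->
  Dlambda hq r lp lm m n = \sum_(a < p) \sum_(b < p)
    if (b == a + s %[mod p])%N then
      ((- 'i%C * (r^-1 * (q ^- n * q ^+ b)) * lp%:C) ^+ a / qfact q a *
        ((- 'i%C * (r * q ^- n) * lm%:C) ^+ b / qfact q b)) *:
       Emon hq (wave (- lp ^+ p) (- lm ^+ p)) a b n
    else 0.
Proof.
move=> smn; rewrite /Dlambda Tlambda_dl Sform_sumr [RHS]exchange_big.
apply: eq_bigr => b _ /=; rewrite Sform_sumr; apply: eq_bigr => a _.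
rewrite Sform_tens SOform_dl star1 mul1r exprV_shift.
suff -> : (p %| p - m + (n + b * p.-1 + a))%N = (b == a + s %[mod p])%N.
  by case: ifP => _; rewrite ?scale1r ?scale0r.
have smaE : (a + s + m = a + n %[mod p])%N.
  by rewrite -addnA -modnDmr smn modnDmr.
rewrite -(eqn_modDr m b) smaE eq_sym /dvdn -(mod0n p).
(* Adding b + m to both sides eliminates the complements p - m and b(p - 1). *)
rewrite -(eqn_modDr (b + m)%N) add0n.
by rewrite addn_complement// modnMDl.
Qed.

Lemma xi_etam_delta (W : Cinf R) (x y : R[i]) k s n :
  Ecoeff hq W * (x *: xi hq ^+ k * (y *: etam hq) ^+ s * delta hq ^+ n) =
  (x * q ^+ (k * k) * y ^+ s) *: Emon hq W k (k + s) n.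
Proof.
rewrite xiX exprZn etamX deltaX scalerA; set z := x * _.
rewrite -[_ * (y ^+ s *: _)]scalerAr -2!scalerAl -scalerAr !EmonM.
rewrite -scalerAl -scalerAr !scalerA (mulrC _ z); congr (_ *: _).
rewrite /Ecoeff !EmonM !addn0 !Ecoef00 !mul0n !muln0 expr0 !scale1r !mulr1.
by rewrite !add0n.
Qed.

(** Unlike in [xi_etam_delta], delta^n stands to the left of xi^k: moving it past 2k generators eta
    costs q^(-4nk). *)
Lemma etap_delta_xi (W : Cinf R) (x y : R[i]) k t n :
  Ecoeff hq W * ((y *: etap hq) ^+ t * delta hq ^+ n * (x *: xi hq ^+ k)) =
  (x * q ^+ (k * k) * y ^+ t * q ^- n ^+ (2 * (k + k))) *:
    Emon hq W (k + t) k n.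
Proof.
rewrite xiX exprZn etapX deltaX scalerA; set z := x * _.
rewrite -[_ * (z *: _)]scalerAr -2![(y ^+ t *: _) * _]scalerAl.
rewrite -[Ecoeff hq W * (z *: _)]scalerAr -[Ecoeff hq W * _]scalerAr !scalerA.
rewrite /Ecoeff !EmonM !addn0 !add0n !Ecoef00 !mul0n !muln0 expr0.
rewrite !scale1r !mulr1 -scalerAr mulr1 EmonZ scalerA.
by rewrite /Ecoef mul0n muln0 expr0 mul1r (addnC t).
Qed.

(** Pair the k factors x with k of the k + s factors y: the square roots r cancel, (-i)^2 = -1, and
    q^s = q^(n-m) turns q^(-2n+s) into q^(-(m+n)). The remaining q^k in x y gives the q^(k^2) of
    [xiX]. *)
Lemma etam_coefE (r : R[i]) (lp lm : R) (f g : R[i]) k s m n :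
  r != 0 -> q ^+ s * q ^+ m = q ^+ n ->
  (- 'i%C * (r^-1 * (q ^- n * q ^+ (k + s))) * lp%:C) ^+ k / f *
    ((- 'i%C * (r * q ^- n) * lm%:C) ^+ (k + s) / g) =
  (- (lp * lm)%:C) ^+ k * q ^- (k * (m + n)) / (g * f) * q ^+ (k * k) *
    (- 'i%C * (r * q ^- n) * lm%:C) ^+ s.
Proof.
move=> r0 qs; set y := - 'i%C * (r * q ^- n) * lm%:C.
set x := - 'i%C * _ * lp%:C.
have xy : x * y = - (lp * lm)%:C * q ^- (m + n) * q ^+ k.
  have -> : q ^- (m + n) = q ^- n * q ^- n * q ^+ s.
    by rewrite exprD -qs; field; rewrite !expf_neq0.
  rewrite /x /y exprD rmorphM /=.
  transitivity ('i%C ^+ 2 * (r^-1 * r) * (lp%:C * lm%:C) *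
    (q ^- n * q ^- n * q ^+ s) * q ^+ k); first by ring.
  by rewrite sqr_i mulVf//; ring.
rewrite exprD invfM; transitivity ((x * y) ^+ k * y ^+ s * g^-1 * f^-1).
  by move: x y {xy} => x y; rewrite exprMn; ring.
have -> : q ^- (k * (m + n)) = q ^- (m + n) ^+ k by rewrite exprVn -exprM mulnC.
by rewrite xy !exprMn (exprM q k k); ring.
Qed.

(** With q^k taken out of the first base, (x q^k)^(k+t) y^k = (x y q^t)^k q^(k^2) x^t. Since q^t =
    q^(m-n), the power of q in x y q^t is q^(m-3n) = q^(m+n) q^(-4n), and q^(-4n) accounts for
    moving delta^n past xi. *)
Lemma etap_coefE (r : R[i]) (lp lm : R) (f g : R[i]) k t m n :
  r != 0 -> q ^+ t * q ^+ n = q ^+ m ->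
  (- 'i%C * (r^-1 * (q ^- n * q ^+ k)) * lp%:C) ^+ (k + t) / f *
    ((- 'i%C * (r * q ^- n) * lm%:C) ^+ k / g) =
  (- (lp * lm)%:C) ^+ k * q ^+ (k * (m + n)) / (g * f) * q ^+ (k * k) *
    (- 'i%C * (r^-1 * q ^- n) * lp%:C) ^+ t * q ^- n ^+ (2 * (k + k)).
Proof.
move=> r0 qt; set y := - 'i%C * (r * q ^- n) * lm%:C.
set x := - 'i%C * (r^-1 * q ^- n) * lp%:C.
have -> : - 'i%C * (r^-1 * (q ^- n * q ^+ k)) * lp%:C = x * q ^+ k.
  by rewrite /x; ring.
have xy : x * y * q ^+ t = - (lp * lm)%:C * q ^+ (m + n) * q ^- n ^+ 4.
  rewrite exprD -qt rmorphM /=.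
  transitivity ('i%C ^+ 2 * (r^-1 * r) * (lp%:C * lm%:C) *
    q ^- n ^+ 2 * q ^+ t).
    by rewrite /x /y; ring.
  by rewrite sqr_i mulVf//; field; rewrite expf_neq0.
transitivity ((x * y * q ^+ t) ^+ k * q ^+ (k * k) * x ^+ t * g^-1 * f^-1).
  move: x y {xy} => x y.
  by rewrite !exprMn !exprD (exprM q k k) -(exprM q t) (mulnC t) exprM; ring.
have -> : q ^- n ^+ (2 * (k + k)) = (q ^- n ^+ 4) ^+ k.
  by rewrite -exprM; congr (_ ^+ _); lia.
have -> : q ^+ (k * (m + n)) = q ^+ (m + n) ^+ k by rewrite -exprM mulnC.
by rewrite xy !exprMn invfM; ring.
Qed.

End representation.

(** Common form of both cases, with s a representative of n - m between 0 and p and t = p - s. The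
    parameters s', t', u, v absorb the different spellings of the bounds and factorial arguments
    under truncated subtraction. *)
Lemma Dlambda_split (R : realType) (p : nat) (q r : R[i]) (lp lm : R)
    (hq : p.-primitive_root q) (m n : 'I_p) (s t s' t' : nat)
    (u v : nat -> nat) :
  r != 0 -> (s + t = p)%N -> (s + m = n %[mod p])%N -> s' = s -> t' = t ->
  (forall k, u k = k + s)%N -> (forall k, v k = k + t)%N ->
  Dlambda hq r lp lm m n =
  Ecoeff hq (wave (- lp ^+ p) (- lm ^+ p)) *
   ((\sum_(k < t')
      ((- (lp * lm)%:C) ^+ k * q ^- (k * (m + n)) /
         (qfact q k * qfact q (u k))) *: xi hq ^+ k)
      * ((- 'i%C * (r * q ^- n) * lm%:C) *: etam hq) ^+ s * delta hq ^+ n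
    + ((- 'i%C * (r^-1 * q ^- n) * lp%:C) *: etap hq) ^+ t * delta hq ^+ n *
      (\sum_(k < s')
        ((- (lp * lm)%:C) ^+ k * q ^+ (k * (m + n)) /
           (qfact q k * qfact q (v k))) *: xi hq ^+ k)).
Proof.
move=> r0 stp smn -> -> uE vE; rewrite (Dlambda_sum hq r lp lm smn).
have le_sp : (s <= p)%N by rewrite -stp leq_addr.
rewrite [LHS](sum_modn_shift (fun a b : nat =>
  ((- 'i%C * (r^-1 * (q ^- n * q ^+ b)) * lp%:C) ^+ a / qfact q a *
    ((- 'i%C * (r * q ^- n) * lm%:C) ^+ b / qfact q b)) *:
  Emon hq (wave (- lp ^+ p) (- lm ^+ p)) a b n) le_sp) /=.
have -> : (p - s = t)%N by rewrite -stp addKn.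
have qs : q ^+ s * q ^+ m = q ^+ n.
  by apply/eqP; rewrite -exprD (eq_prim_root_expr hq) smn.
have qt : q ^+ t * q ^+ n = q ^+ m.
  by rewrite -qs mulrA -exprD addnC stp (prim_expr_order hq) mul1r.
(* The pairs b = a + s leave a surplus eta_-^s, the pairs a = b + t a surplus eta_+^t. *)
rewrite mulrDr; congr (_ + _).
  rewrite [RHS]mulr_sum_mid; apply: eq_bigr => k _.
  rewrite uE (xi_etam_delta hq) (etam_coefE hq _ _ _ _ _ r0 qs).
  by rewrite (mulrC (qfact q k)).
rewrite [RHS]mulr_sum_last; apply: eq_bigr => k _.
by rewrite vE (etap_delta_xi hq) (etap_coefE hq _ _ _ _ _ r0 qt).
Qed.

Theorem proposition2 (R : realType) (p : nat) (q r : R[i]) (lp lm : R)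
    (p_ge3 : (3 <= p)%N) (p_odd : odd p) (hq : p.-primitive_root q)
    (hr : r ^+ 2 = q) (lambda_neq0 : (lp, lm) != (0, 0)) (m n : 'I_p) :
  let lambda2 : R[i] := (lp * lm)%:C in
  let ep : Ealg (Cinf R) hq := etap hq in
  let em : Ealg (Cinf R) hq := etam hq in
  let d : Ealg (Cinf R) hq := delta hq in
  let fact := qfact q in
  let phase := Ecoeff hq (wave (- lp ^+ p) (- lm ^+ p)) in
  ((m <= n)%N ->
    Dlambda hq r lp lm m n = phase *
      ((\sum_(k < p - n + m)
          ((- lambda2) ^+ k * q ^- (k * (m + n)) / (fact k * fact (k + n - m)%N))
            *: xi hq ^+ k)
         * ((- 'i%C * (r * q ^- n) * lm%:C) *: em) ^+ (n - m) * d ^+ n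
       + ((- 'i%C * (r^-1 * q ^- n) * lp%:C) *: ep) ^+ (p + m - n) * d ^+ n
         * (\sum_(k < n - m)
          ((- lambda2) ^+ k * q ^+ (k * (m + n))
             / (fact k * fact (k + p + m - n)%N))
            *: xi hq ^+ k)))
  /\
  ((n <= m)%N ->
    Dlambda hq r lp lm m n = phase *
      ((\sum_(k < m - n)
          ((- lambda2) ^+ k * q ^- (k * (m + n))
             / (fact k * fact (k + p + n - m)%N))
            *: xi hq ^+ k)
         * ((- 'i%C * (r * q ^- n) * lm%:C) *: em) ^+ (p + n - m) * d ^+ n
       + ((- 'i%C * (r^-1 * q ^- n) * lp%:C) *: ep) ^+ (m - n) * d ^+ n
         * (\sum_(k < p - m + n)
          ((- lambda2) ^+ k * q ^+ (k * (m + n)) / (fact k * fact (k + m - n)%N))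
            *: xi hq ^+ k))).
Proof.
have r0 : r != 0.
  by rewrite -sqrf_eq0 hr (prim_root_eq0 hq) -lt0n (p_gt0 hq).
have [lt_m lt_n] := (ltn_ord m, ltn_ord n).
move=> lambda2 ep em d fact phase; split=> [le_mn|le_nm].
  apply: (@Dlambda_split R p q r lp lm hq m n (n - m) (p + m - n) (n - m)
    (p - n + m) (fun k => k + n - m)%N (fun k => k + p + m - n)%N) => //.
  - by lia.
  - by rewrite subnK.
  - by lia.
  - by move=> k; lia.
  - by move=> k; lia.
(* Here s = p + n - m. For m = n this is s = p, t = 0: the first sum is empty and all terms lie in
   the second. *)
apply: (@Dlambda_split R p q r lp lm hq m n (p + n - m) (m - n) (p - m + n)
  (m - n) (fun k => k + p + n - m)%N (fun k => k + m - n)%N) => //.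
- by lia.
- by rewrite subnK ?modnDl//; lia.
- by lia.
- by move=> k; lia.
- by move=> k; lia.
Qed.
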